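(* Let $G$ be a graph with orientation $D$ and let $\alpha$ be an admissible assigning of $G$. Then $\tau(G,\alpha;k)$ and $p\big(M(G),\alpha_{\Gamma(G),\psi};k\big)$ are the same polynomial, and they satisfy \[ \tau(G,\alpha;k)=p\big(M(G),\alpha_{\Gamma(G),\psi};k\big)=|A_\psi[\Gamma(G)]|=|\Delta_f(G,A)| \] for every Abelian group $A$ of order $k$, every function $f:E(G)\to A$ satisfying $\alpha_{D,f}=\alpha$, and every homomorphism $\psi:\Gamma(G)\to A$ such that $\psi(\eta_{D(C)})=-\sum_{e\in E(G)}f(e)\cdot\eta_{D(C)}(e)$ for any cycle $C$ of $G$. Furthermore, $\tau(G,\alpha;k)$ has degree $|V(G)|-c(G)$ if $\alpha(e)=1$ for any loop $e$ of $G$ and equals zero otherwise, and for $e\in E(G)$, $\tau(G,\alpha;k)$ also satisfies \[ \tau(G,\alpha;k)= \begin{cases} 1,&\text{if $E(G)=\emptyset$};\\ (k-1)\tau(G-e,\alpha_{G-e};k),&\text{if $e$ is a bridge};\\ \alpha(e)\tau(G-e,\alpha_{G-e};k),&\text{if $e$ is a loop};\\ \tau(G-e,\alpha_{G-e};k)-\tau(G/e,\alpha_{G/e};k),&\text{otherwise}. \end{cases} \]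
   Context: Graphs are finite and may have loops and multiple edges; Abelian groups $A$ are additive and finite; $D$ is an arbitrary fixed orientation of $G$. Assignings. A cycle of $G$ is a connected 2-regular subgraph (a loop with its vertex is a cycle with one edge; two parallel edges form a cycle); $\mathcal{C}(G)$ is the set of cycles. An assigning of $G$ is a map $\alpha:\mathcal{C}(G)\to\{0,1\}$; for a loop $e$, $\alpha(e)$ is the value of $\alpha$ on the cycle formed by $e$. For each cycle $C$ fix one of its two directions $o(C)$ and define $\eta_{D(C)}:E(G)\to\{0,\pm1\}$ by $\eta_{D(C)}(e)=1$ if $e\in E(C)$ and the direction of $e$ under $D$ is consistent with $o(C)$, $-1$ if $e\in E(C)$ and the direction of $e$ is opposite to $o(C)$, and $0$ if $e\notin E(C)$. For $f:E(G)\to A$, set $\alpha_{D,f}(C)=0$ if $\sum_{e\in E(C)}\eta_{D(C)}(e)f(e)=0$ and $1$ otherwise. An assigning $\alpha$ is admissible if $\alpha=\alpha_{D,f}$ for some finite Abelian group $A$ and some $f:E(G)\to A$. A subgraph $H$ is $\alpha$-compatible if $\alpha(C)=0$ for every cycle $C$ of $H$. With $c(H)$ the number of components of $H$ and $r(H)=|V(G)|-c(H)$ for a spanning subgraph $H$ (one with $V(H)=V(G)$), define \[ \tau(G,\alpha;k):=\sum_{H}(-1)^{|E(H)|}k^{r(G)-r(H)}, \] the sum over all $\alpha$-compatible spanning subgraphs $H$ of $G$. Deletion and contraction. $G-e$ is $G$ with $e$ removed; if $e$ is a link (distinct ends), $G/e$ is obtained by identifying the ends of $e$ and removing $e$. $\alpha_{G-e}$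 is the restriction of $\alpha$ to $\mathcal{C}(G-e)$. For a link $e$, each cycle of $G/e$ either is (on the same edge set) a cycle $C$ of $G$ with $e\notin E(C)$, and then $\alpha_{G/e}(C):=\alpha(C)$, or is $C/e$ for a cycle $C$ of $G$ containing $e$, and then $\alpha_{G/e}(C/e):=\alpha(C)$. Tensions. A map $t:E(G)\to A$ is a tension if there is $c:V(G)\to A$ with $t(e)=c(v)-c(u)$ for each edge $e$ directed from $u$ to $v$ under $D$ (so $t(e)=0$ for loops). For $f:E(G)\to A$, $\Delta_f(G,A)$ is the set of tensions $t$ with $t(e)\neq f(e)$ for all $e\in E(G)$. Chain groups. For $a\in A$ and $z\in\mathbb{Z}$, $a\cdot z$ is the $\mathbb{Z}$-module multiple. A regular chain group $N$ on a finite set $E$ is the set of integral vectors in $\mathbb{Z}^E$ orthogonal to every row of a totally unimodular matrix $U$ with columns indexed by $E$; $M(N)$ is the regular matroid on $E$ represented by $U$. A nonzero chain $f\in N$ is elementary if no nonzero $g\in N$ has support $\sigma(g)\subsetneq\sigma(f)$, and primitive if moreover its values lie in $\{0,\pm1\}$; the circuits of $M(N)$ are exactly the supports of primitive chains of $N$. $\Gamma(G)$ is the regular chain group on $E(G)$ associated with the vertex–arc incidence matrix of $D(G)$ (entry $1$ at the head and $-1$ at the tail of each link, $0$ otherwise, so loop columns are zero); it is generated by $\{\eta_{D(C)}: C\in\mathcal{C}(G)\}$. $M(G)=M(\Gamma(G))$ is the cycle matroid of $G$. For a homomorphism $\psi:N\to A$, \[ A_\psi[N]:=\Big\{g\in(A\setminus\{0\})^E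 : \sum_{e\in E}g(e)\cdot f(e)=\psi(f)\text{ for all } f\in N\Big\}. \] An assigning of a matroid $M$ is a map from its circuits to $\{0,1\}$. The homomorphism $\psi$ induces the assigning $\alpha_{N,\psi}$ of $M(N)$ with $\alpha_{N,\psi}(\sigma(c))=0$ if $\psi(c)=0$ and $1$ if $\psi(c)\neq0$, for each primitive chain $c$ of $N$. An assigning $\alpha$ of $M$ is homogeneous if $\alpha=\alpha_{N,\psi}$ for some such $N$ with $M(N)=M$, some $A$ and some $\psi:N\to A$. By a theorem of Kochol, for every regular matroid $M$ on $E$ and homogeneous assigning $\alpha$ of $M$ there is a (unique) polynomial $p(M,\alpha;k)$, the $\alpha$-assigning polynomial, such that $p(M,\alpha;k)=|A_\psi[N]|$ for every regular chain group $N$ on $E$ with $M(N)=M$, every Abelian group $A$ of order $k$, and every homomorphism $\psi:N\to A$ with $\alpha_{N,\psi}=\alpha$; this defines $p$. *)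

(* Defs.v *)
From HB Require Import structures.
From mathcomp Require Import all_boot all_order all_algebra.
From mathcomp Require Import boolp.
From mathcomp Require classical_sets.

Set Implicit Arguments.
Unset Strict Implicit.
Unset Printing Implicit Defensive.

Import Order.TTheory GRing.Theory Num.Theory.
Local Open Scope ring_scope.

(** * Graphs and cycles *)

(* Finite multigraph: a loop has one end, a link has two. *)
Record mgraph := MGraph {
  vertex : finType;
  edge : finType;
  ends : edge -> {set vertex};
  ends_card : forall e, (0 < #|ends e| <= 2)%N }.

Definition is_loop (G : mgraph) (e : edge G) : bool := #|ends e| == 1%N.

Definition adj (G : mgraph) (F : {set edge G}) : rel (vertex G) :=
  fun u v => [exists e in F, ends e == [set u; v]].

(* The spanning subgraph with edge set F is represented by F. *)
Definition ncomp (G : mgraph) (F : {set edge G}) : nat :=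
  n_comp (adj F) [set: vertex G].

Definition grank (G : mgraph) (F : {set edge G}) : nat :=
  (#|vertex G| - ncomp F)%N.

Definition vset (G : mgraph) (F : {set edge G}) : {set vertex G} :=
  \bigcup_(e in F) ends e.

Definition degree (G : mgraph) (F : {set edge G}) (v : vertex G) : nat :=
  \sum_(e in F | v \in ends e) (if is_loop e then 2 else 1)%N.

(* A 2-regular subgraph has no isolated vertex, so it is given by its edge set
   C, its vertex set being vset C. *)
Definition is_cycle (G : mgraph) (C : {set edge G}) : bool :=
  [&& C != set0,
      [forall v in vset C, degree C v == 2] &
      [forall u in vset C, forall v in vset C, connect (adj C) u v]].

Definition gcycle (G : mgraph) := {C : {set edge G} | is_cycle C}.

(** * Assignings and the polynomial tau *)

Definition gassigning (G : mgraph) := gcycle G -> bool.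

(* The value of alpha on the cycle with edge set F; the default is used only
   when F is not (the edge set of) a cycle. *)
Definition gval (G : mgraph) (alpha : gassigning G) (F : {set edge G}) : bool :=
  if insub F is Some C then alpha C else false.

Definition loop_val (G : mgraph) (alpha : gassigning G) (e : edge G) : bool :=
  gval alpha [set e].

Definition compatible (G : mgraph) (alpha : gassigning G) (F : {set edge G}) :=
  [forall C : gcycle G, (val C \subset F) ==> ~~ alpha C].

Definition tau (G : mgraph) (alpha : gassigning G) : {poly int} :=
  \sum_(F : {set edge G} | compatible alpha F)
     (-1) ^+ #|F| *: 'X^(grank [set: edge G] - grank F).

(** * Deletion and contraction *)

Definition del_edge (G : mgraph) (e : edge G) := {x : edge G | x != e}.

Definition gdel (G : mgraph) (e : edge G) : mgraph :=
  @MGraph (vertex G) (del_edge e) (fun x => ends (val x))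
          (fun x => ends_card (val x)).

Definition bridge (G : mgraph) (e : edge G) : bool :=
  (ncomp [set: edge G] < ncomp [set: edge (gdel e)])%N.

Definition del_assigning (G : mgraph) (e : edge G) (alpha : gassigning G) :
    gassigning (gdel e) :=
  fun C => gval alpha [set val x | x in val C].

Arguments del_assigning {G} e alpha C.

(* The vertices of G/e are the blocks of the partition of V(G) whose only
   possibly nontrivial block is the set of ends of e. *)
Definition merge (G : mgraph) (e : edge G) (v : vertex G) : {set vertex G} :=
  if v \in ends e then ends e else [set v].

Definition contr_vertex (G : mgraph) (e : edge G) :=
  {B : {set vertex G} | B \in codom (merge e)}.

Definition proj (G : mgraph) (e : edge G) (v : vertex G) : contr_vertex e :=
  exist _ (merge e v) (codom_f (merge e) v).

Definition contr_ends (G : mgraph) (e : edge G) (x : del_edge e) :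
    {set contr_vertex e} :=
  [set proj e v | v in ends (val x)].

Lemma contr_ends_card (G : mgraph) (e : edge G) (x : del_edge e) :
  (0 < #|contr_ends x| <= 2)%N.
Proof.
have /andP[x0 x2] := ends_card (val x); apply/andP; split.
  have /card_gt0P[v xv] := x0.
  by apply/card_gt0P; exists (proj e v); apply: imset_f.
by apply: leq_trans x2; apply: leq_imset_card.
Qed.

Definition gcontr (G : mgraph) (e : edge G) : mgraph :=
  @MGraph (contr_vertex e) (del_edge e) (@contr_ends G e) (@contr_ends_card G e).

(* For a link e, a cycle of G/e with edge set F (seen in G) is either a cycle
   of G or becomes one after adding e. *)
Definition contr_assigning (G : mgraph) (e : edge G) (alpha : gassigning G) :
    gassigning (gcontr e) :=
  fun C => let F := [set val x | x in val C] in
    if is_cycle F then gval alpha F else gval alpha (e |: F).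

Arguments contr_assigning {G} e alpha C.

(** * Orientations, directions of cycles, admissible assignings *)

Record orientation (G : mgraph) := Orientation {
  tail : edge G -> vertex G;
  head : edge G -> vertex G;
  orientationP : forall e, ends e = [set tail e; head e] }.

(* The dart (e, true) follows e along D, (e, false) against D; so a loop has
   two darts, hence two directions. *)
Definition dtail (G : mgraph) (D : orientation G) (d : edge G * bool) : vertex G :=
  if d.2 then tail D d.1 else head D d.1.

Definition dhead (G : mgraph) (D : orientation G) (d : edge G * bool) : vertex G :=
  if d.2 then head D d.1 else tail D d.1.

(* A direction of C: a closed traversal of C using each edge exactly once. *)
Record direction (G : mgraph) (D : orientation G) (C : gcycle G) := Direction {
  walk : seq (edge G * bool);
  walk_uniq : uniq [seq d.1 | d <- walk];
  walk_edges : forall e, (e \in [seq d.1 | d <- walk]) = (e \in val C);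
  walk_closed : path.cycle (fun d d' => dhead D d == dtail D d') walk }.

Definition directions (G : mgraph) (D : orientation G) :=
  forall C : gcycle G, direction D C.

Definition eta (G : mgraph) (D : orientation G) (o : directions D)
    (C : gcycle G) : {ffun edge G -> int} :=
  [ffun e => if (e, true) \in walk (o C) then 1
             else if (e, false) \in walk (o C) then -1 else 0].

Definition assigning_of (G : mgraph) (D : orientation G) (o : directions D)
    (A : finZmodType) (f : edge G -> A) : gassigning G :=
  fun C => \sum_(e in val C) f e *~ eta o C e != 0.

Definition admissible (G : mgraph) (D : orientation G) (o : directions D)
    (alpha : gassigning G) : Prop :=
  exists (A : finZmodType) (f : edge G -> A), alpha =1 assigning_of o f.

(** * Tensions *)

Definition tension (G : mgraph) (D : orientation G) (A : finZmodType)
    (t : {ffun edge G -> A}) : bool :=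
  [exists c : {ffun vertex G -> A},
     [forall e, t e == c (head D e) - c (tail D e)]].

Definition Delta (G : mgraph) (D : orientation G) (A : finZmodType)
    (f : edge G -> A) : {set {ffun edge G -> A}} :=
  [set t | tension D t && [forall e, t e != f e]].

(** * Matroids *)

Record matroid (E : finType) := Matroid {
  indep : {set {set E}};
  indep0 : set0 \in indep;
  indepS : forall X Y : {set E}, X \subset Y -> Y \in indep -> X \in indep;
  indep_augment : forall X Y : {set E}, X \in indep -> Y \in indep ->
    (#|X| < #|Y|)%N -> exists2 y, y \in Y :\: X & y |: X \in indep }.

Definition circuit (E : finType) (M : matroid E) (C : {set E}) : bool :=
  minset (fun X => X \notin indep M) C.

Definition mcircuit (E : finType) (M : matroid E) :=
  {C : {set E} | circuit M C}.

Definition massigning (E : finType) (M : matroid E) := mcircuit M -> bool.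

(* Matrices have rows indexed by a finite type I and columns indexed by E. *)
Definition mxcolumn (I E : finType) (U : I -> E -> int) (e : E) :
    {ffun I -> rat^o} :=
  [ffun i => (U i e)%:~R].

Definition column_free (I E : finType) (U : I -> E -> int) (X : {set E}) :=
  free [seq mxcolumn U e | e <- enum X].

Definition column_indep (I E : finType) (U : I -> E -> int) : {set {set E}} :=
  [set X : {set E} | column_free U X].

Lemma column_indep0 (I E : finType) (U : I -> E -> int) :
  set0 \in column_indep U.
Proof. by rewrite inE /column_free enum_set0 nil_free. Qed.

Lemma column_indepS (I E : finType) (U : I -> E -> int) (X Y : {set E}) :
  X \subset Y -> Y \in column_indep U -> X \in column_indep U.
Proof.
move=> sXY; rewrite !inE /column_free => freeY.
have XY : perm_eq (enum X) [seq x <- enum Y | x \in X].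
  apply: uniq_perm; [exact: enum_uniq|exact/filter_uniq/enum_uniq|move=> x].
  rewrite mem_enum [RHS]mem_filter mem_enum; case xX: (x \in X) => //=.
  by rewrite (subsetP sXY).
rewrite (perm_free (perm_map _ XY)).
move: freeY; set h := mxcolumn U.
have YY : perm_eq (enum Y) ([seq x <- enum Y | x \in X] ++
                            [seq x <- enum Y | x \notin X]).
  by rewrite perm_sym perm_filterC.
by rewrite (perm_free (perm_map h YY)) map_cat => /catl_free.
Qed.

Lemma column_indep_augment (I E : finType) (U : I -> E -> int) (X Y : {set E}) :
  X \in column_indep U -> Y \in column_indep U -> (#|X| < #|Y|)%N ->
  exists2 y, y \in Y :\: X & y |: X \in column_indep U.
Proof.
rewrite !inE /column_free => freeX freeY ltXY.
set h := mxcolumn U in freeX freeY *.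
case: (pickP [pred y in Y | h y \notin <<[seq h e | e <- enum X]>>%VS]).
  move=> y /andP[yY hy]; have yX : y \notin X.
    by apply: contra hy => yX; rewrite memv_span // map_f // mem_enum.
  exists y; first by rewrite inE yX.
  rewrite inE /column_free -/h.
  have P : perm_eq (enum (y |: X)) (y :: enum X).
    apply: uniq_perm; rewrite /= ?enum_uniq ?mem_enum ?yX // => x.
    by rewrite inE !mem_enum !inE.
  by rewrite (perm_free (perm_map h P)) /= free_cons hy.
move=> hY; exfalso.
have sYX : (<<[seq h e | e <- enum Y]>> <= <<[seq h e | e <- enum X]>>)%VS.
  apply/span_subvP => _ /mapP[y yY ->]; rewrite mem_enum in yY.
  by have := hY y; rewrite /= yY /= => /negbFE.
have := dimvS sYX; move: freeX freeY; rewrite /free !size_map -!cardE.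
by move=> /eqP-> /eqP->; rewrite leqNgt ltXY.
Qed.

Definition column_matroid (I E : finType) (U : I -> E -> int) : matroid E :=
  Matroid (column_indep0 U) (@column_indepS I E U) (@column_indep_augment I E U).

(** * Regular chain groups *)

Definition totally_unimodular (I E : finType) (U : I -> E -> int) : Prop :=
  forall (n : nat) (r : 'I_n -> I) (c : 'I_n -> E), injective r -> injective c ->
    \det (\matrix_(i, j) U (r i) (c j)) \in [:: 0; 1; -1].

Definition chains (I E : finType) (U : I -> E -> int) :
    {pred {ffun E -> int}} :=
  fun f => [forall i, \sum_e U i e * f e == 0].

Lemma chains_zmod_closed (I E : finType) (U : I -> E -> int) :
  zmod_closed (chains U).
Proof.
split=> [|f g /forallP Uf /forallP Ug]; apply/forallP => i.
  by rewrite big1 // => e _; rewrite ffunE mulr0.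
rewrite (eq_bigr (fun e => U i e * f e - U i e * g e)); last first.
  by move=> e _; rewrite !ffunE mulrBr.
by rewrite sumrB (eqP (Uf i)) (eqP (Ug i)) subr0.
Qed.

HB.instance Definition _ (I E : finType) (U : I -> E -> int) :=
  GRing.isZmodClosed.Build {ffun E -> int} (chains U) (chains_zmod_closed U).

(* The chain group of U, regular when U is totally unimodular; its matroid is
   column_matroid U. *)
Record chain (I E : finType) (U : I -> E -> int) := Chain {
  chain_val :> {ffun E -> int};
  chainP : chain_val \in chains U }.

HB.instance Definition _ (I E : finType) (U : I -> E -> int) :=
  [isSub for @chain_val I E U].
HB.instance Definition _ (I E : finType) (U : I -> E -> int) :=
  [Choice of chain U by <:].
HB.instance Definition _ (I E : finType) (U : I -> E -> int) :=
  [SubChoice_isSubZmodule of chain U by <:].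

Definition csupp (I E : finType) (U : I -> E -> int) (f : chain U) : {set E} :=
  [set e | f e != 0].

Definition elementary (I E : finType) (U : I -> E -> int) (f : chain U) : Prop :=
  f != 0 /\ forall g : chain U, g != 0 -> ~~ (csupp g \proper csupp f).

Definition primitive (I E : finType) (U : I -> E -> int) (f : chain U) : Prop :=
  elementary f /\ forall e, f e \in [:: 0; 1; -1].

Definition nz_solutions (I E : finType) (U : I -> E -> int) (A : finZmodType)
    (psi : {additive chain U -> A}) : {set {ffun E -> A}} :=
  [set g : {ffun E -> A} | [forall e, g e != 0] &&
     `[< forall f : chain U, \sum_e g e *~ f e = psi f >]].

(* Meant for M = column_matroid U with U totally unimodular: then every circuit
   of M supports exactly two primitive chains, c and - c, so it does not matter
   which of them is tested. *)
Definition induced_assigning (E : finType) (M : matroid E) (I : finType)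
    (U : I -> E -> int) (A : finZmodType) (psi : {additive chain U -> A}) :
    massigning M :=
  fun C => `[< exists c : chain U,
                 [/\ primitive c, csupp c = val C & psi c != 0] >].

Arguments induced_assigning {E} M {I U A} psi C.

Definition is_assigning_poly (E : finType) (M : matroid E)
    (alpha : massigning M) (p : {poly int}) : Prop :=
  forall (I : finType) (U : I -> E -> int),
    totally_unimodular U -> column_matroid U = M ->
  forall (A : finZmodType) (psi : {additive chain U -> A}),
    induced_assigning M psi =1 alpha ->
  p.[#|A|%:R] = #|nz_solutions psi|%:R.

(* By Kochol's theorem is_assigning_poly determines a unique polynomial when M
   is regular and alpha is homogeneous. *)
Definition assigning_poly (E : finType) (M : matroid E) (alpha : massigning M) :
    {poly int} :=
  classical_sets.xget 0 (fun p : {poly int} => is_assigning_poly alpha p).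

(** * The chain group of a graph *)

Definition incidence (G : mgraph) (D : orientation G) :
    vertex G -> edge G -> int :=
  fun v e => (head D e == v)%:R - (tail D e == v)%:R.

Definition Gamma (G : mgraph) (D : orientation G) := chain (incidence D).

Definition cycle_matroid (G : mgraph) (D : orientation G) : matroid (edge G) :=
  column_matroid (incidence D).

Lemma eta_chains (G : mgraph) (D : orientation G) (o : directions D)
    (C : gcycle G) : eta o C \in chains (incidence D).
Proof.
apply/forallP => v; apply/eqP.
have -> : \sum_e incidence D v e * eta o C e =
    \sum_(d <- walk (o C)) ((dhead D d == v)%:R - (dtail D d == v)%:R) :> int.
  have uw := walk_uniq (o C); rewrite /eta; move: (walk (o C)) uw => w.
  elim: w => [|[e b] w IH] /=.
    by rewrite big_nil big1 // => e _; rewrite ffunE mulr0.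
  case/andP=> ew /IH{}IH; rewrite big_cons -IH (bigD1 e) //=.
  rewrite [in RHS](bigD1 e) //= !ffunE.
  have nw c : (e, c) \in w = false.
    by apply: contraNF ew => cw; apply/mapP; exists (e, c).
  rewrite !inE !nw !orbF !xpair_eqE eqxx /= mulr0 add0r; congr (_ + _).
    by rewrite /incidence /dhead /dtail; case: b; rewrite /= ?mulr1 // mulrN1 opprB.
  apply: eq_bigr => x xe; rewrite !ffunE !inE !xpair_eqE.
  by rewrite (negPf xe).
have := walk_closed (o C); case: (walk (o C)) => [|d w] /=.
  by rewrite big_nil.
have T x s : path (fun d d' => dhead D d == dtail D d') x s ->
    \sum_(y <- x :: s) ((dhead D y == v)%:R - (dtail D y == v)%:R) =
    (dhead D (last x s) == v)%:R - (dtail D x == v)%:R :> int.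
  elim: s x => [|y s IH] x /=; first by rewrite big_seq1.
  case/andP=> /eqP xy /IH; rewrite big_cons => ->.
  by rewrite xy addrC addrA subrK.
rewrite rcons_path => /andP[pw /eqP lw].
by rewrite (T _ _ pw) lw subrr.
Qed.

Definition eta_chain (G : mgraph) (D : orientation G) (o : directions D)
    (C : gcycle G) : Gamma D :=
  Chain (eta_chains o C).

(* Main.v *)
From HB Require Import structures.
From mathcomp Require Import all_boot all_order all_algebra.
From mathcomp Require Import boolp zify.
From mathcomp Require classical_sets.
Require Import Defs.

Set Implicit Arguments.
Unset Strict Implicit.
Unset Printing Implicit Defensive.

Import Order.TTheory GRing.Theory Num.Theory.
Local Open Scope ring_scope.

(** All the counts in the theorem come from one inclusion-exclusion ([sieve]).

For tensions, sieve over the set F of edges at which a tension agrees with f.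
A tension agreeing with f on F exists exactly when f is a potential difference
on F, that is, when its signed sums around all cycles inside F vanish
([compatible_vanishes], [balancedP]): this is compatibility of F.  Such tensions
then form a coset of those vanishing on F, which are the differences of the
potentials constant on the components of F, so there are k^(c(F) - c(G)) of them
([card_tensions]).  Hence tau takes the value |Delta_f| at k ([tau_Delta]).

The map g |-> g + f carries the nowhere-zero solutions for psi to Delta_f,
because the chain group is generated by the chains of cycles
([chain_ind_cycles]): this makes psi(c) = - sum f(e) c(e) hold for every chain c,
and makes tensions the orthogonal of the chain group ([card_nz_solutions]).

For a regular chain group N = chain U, sieve over the set F of zeros of a
solution.  Extend a basis of F to a basis B of the matroid.  Total unimodularity
and Cramer's rule give fundamental chains with values 0, 1, -1
([fundamental_chain]); they generate N over the integers and are primitive.  A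
solution vanishing on F is therefore determined by free values on the part of B
outside F, and it exists exactly when psi kills the primitive chains inside F
([card_solutions_vanishing]).  The result depends only on the matroid and on the
assigning, which is Kochol's theorem ([assigning_polyP]).

So tau and p agree at |A|.  They also agree at |A| (n + 1) for every n, because
(A, f, psi) may be replaced by (A x Z/(n+1), (f, 0), (psi, 0)) without changing
the assignings; hence they are equal ([tau_assigning_poly]).

The recursion is read off the sum defining tau by pairing F with e |: F.  For a
link e that is not a bridge, one must see that F is compatible in G / e exactly
when e |: F is compatible in G.  This is where admissibility enters: a cycle of
G through both ends of e, but not through e, is not a cycle of G / e.  After f
is changed by a potential difference so that f(e) = 0, forgetting the value at e
identifies the chains of G with those of G / e and preserves their pairing with
f ([push_chain], [lift_chain], [compatible_contr]). *)

(** * Regular chain groups *)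

(** Freeness as the absence of linear relations indexed by E itself, which avoids
enumerations of X. *)
Lemma column_freeP (I E : finType) (U : I -> E -> int) (X : {set E}) :
  X \in column_indep U <->
  (forall x : E -> rat, (forall i, \sum_(e in X) x e * (U i e)%:~R = 0) ->
     forall e, e \in X -> x e = 0).
Proof.
rewrite inE /column_free -[[seq _ | _ <- _]]/(tval (map_tuple (mxcolumn U) (in_tuple (enum X)))).
have sz : size (enum X) = #|X| by rewrite cardE.
have nthU (e0 : E) (i : 'I_(size (enum X))) :
    (map_tuple (mxcolumn U) (in_tuple (enum X)))`_i = mxcolumn U (nth e0 (enum X) i).
  by rewrite /= (nth_map e0).
split=> [/freeP fX x x0 e eX|fX].
  have := fX (fun i => x (nth e (enum X) i)) _ .
  have lt_e : (index e (enum X) < size (enum X))%N by rewrite index_mem mem_enum.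
  move/(_ _ (Ordinal lt_e)); rewrite /= nth_index ?mem_enum //; apply.
  apply/ffunP=> i; rewrite sum_ffunE [RHS]ffunE -[RHS](x0 i) -[RHS]big_enum.
  rewrite [RHS](big_nth e) [RHS]big_mkord.
  by apply: eq_bigr => j _; rewrite (nthU e) !ffunE.
apply/freeP => k k0 i.
have e0 : E by move: i; rewrite /=; case: (enum X) => [[]|].
have ui : index (nth e0 (enum X) i) (enum X) = i by rewrite index_uniq ?enum_uniq.
pose x e := if insub (index e (enum X)) is Some j then k j else 0.
have xE (j : 'I_(size (enum X))) : x (nth e0 (enum X) j) = k j.
  by rewrite /x index_uniq ?enum_uniq // valK.
rewrite -xE; apply: fX; last by rewrite -mem_enum mem_nth.
move=> j; rewrite -[LHS]big_enum (big_nth e0) big_mkord.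
have /ffunP/(_ j) := k0; rewrite sum_ffunE [RHS]ffunE => E0; rewrite -[RHS]E0.
by apply: eq_bigr => l _; rewrite (nthU e0) xE !ffunE.
Qed.

Lemma chainE (I E : finType) (U : I -> E -> int) (c : chain U) (i : I) :
  \sum_e U i e * c e = 0.
Proof. by apply/eqP; apply: (forallP (chainP c)). Qed.

Lemma chain_eq0 (I E : finType) (U : I -> E -> int) (c : chain U) :
  (forall e, c e = 0) -> c = 0.
Proof. by move=> c0; apply/val_inj/ffunP => e; rewrite [LHS]c0 ffunE. Qed.

Lemma chainD (I E : finType) (U : I -> E -> int) (c d : chain U) e :
  (c + d) e = c e + d e.
Proof. by rewrite -[chain_val _]/(val (c + d)) GRing.valD ffunE. Qed.

Lemma chainN (I E : finType) (U : I -> E -> int) (c : chain U) e :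
  (- c) e = - c e.
Proof. by rewrite -[chain_val _]/(val (- c)) GRing.valN ffunE. Qed.

Lemma chain0 (I E : finType) (U : I -> E -> int) e : (0 : chain U) e = 0.
Proof. by rewrite -[chain_val _]/(val (0 : chain U)) GRing.val0 ffunE. Qed.

Lemma chain_sum (I E : finType) (U : I -> E -> int) (T : finType) (P : pred T)
    (c : T -> chain U) e : (\sum_(t | P t) c t) e = \sum_(t | P t) c t e.
Proof.
by elim/big_rec2: _ => [|t x y _ <-]; rewrite ?chain0 ?chainD.
Qed.

Lemma chainMz (I E : finType) (U : I -> E -> int) (c : chain U) (z : int) e :
  (c *~ z) e = c e * z.
Proof.
have H n : (c *+ n) e = c e *+ n.
  by elim: n => [|n IH]; rewrite ?chain0 // !mulrS chainD IH.
case: z => n; [rewrite -pmulrn H | rewrite NegzE mulrNz chainN -pmulrn H mulrN].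
  by rewrite -mulr_natr natz.
by rewrite -mulr_natr natz.
Qed.

(** A chain is a linear relation between columns. *)
Lemma chain_indep_eq0 (I E : finType) (U : I -> E -> int) (X : {set E}) (c : chain U) :
  X \in column_indep U -> (forall e, e \notin X -> c e = 0) -> c = 0.
Proof.
move=> /column_freeP fX c0; apply: chain_eq0 => e.
have [eX|/c0//] := boolP (e \in X).
suff /(_ e eX)/eqP : forall e, e \in X -> (c e)%:~R = 0 :> rat by rewrite intr_eq0 => /eqP.
apply: (fX (fun e => (c e)%:~R)) => i.
have := congr1 (fun z : int => z%:~R : rat) (chainE c i).
rewrite rmorph_sum (bigID [in X]) /= => E0; rewrite -[RHS]E0.
rewrite [X in _ = _ + X]big1 ?addr0; last by move=> x xX; rewrite c0 // mulr0.
by apply: eq_bigr => x _; rewrite rmorphM mulrC.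
Qed.

(** The relation expressing column e through the columns of X is read off a
nonsingular square submatrix with columns X; by Cramer's rule its coefficients
are quotients of minors of U. *)
Lemma fundamental_chain (I E : finType) (U : I -> E -> int) (X : {set E}) (e : E) :
  totally_unimodular U -> X \in column_indep U -> e \notin X ->
  e |: X \notin column_indep U ->
  exists c : chain U, [/\ c e = 1, forall x, x \notin e |: X -> c x = 0 &
                          forall x, c x \in [:: 0; 1; -1]].
Proof.
move=> tuU indX eX depX; have /column_freeP freeX := indX.
have [y [ye y0 yU]] : exists y : E -> rat, [/\ y e = 1,
    forall x, x \notin e |: X -> y x = 0 &
    forall i, \sum_(x in X) y x * (U i x)%:~R = - (U i e)%:~R].
  have /column_freeP/existsNP[z] := negP depX.
  move=> /not_implyP[z0 /existsNP[x /not_implyP[xX /eqP zx]]].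
  have ze : z e != 0.
    apply: contraNneq zx => ze; move: xX; rewrite in_setU1 => /predU1P[->|xX].
      exact/eqP.
    apply/eqP; apply: freeX xX => i; rewrite -[RHS](z0 i) big_setU1 //=.
    by rewrite ze mul0r add0r.
  exists (fun x => if x \in e |: X then z x / z e else 0); split.
  - by rewrite setU11 divff.
  - by move=> u /negPf->.
  move=> i; apply: (mulIf ze); apply/eqP; rewrite mulNr -addr_eq0 addrC mulr_suml.
  rewrite -[X in _ == X](z0 i) big_setU1 //= mulrC; apply/eqP; congr (_ + _).
  apply: eq_bigr => u uX; rewrite in_setU1 uX orbT.
  by rewrite mulrAC divfK.
(* A set r of #|X| rows on which the columns of X stay independent. *)
pose v : 'I_#|X| -> E := enum_val.
have vX j : v j \in X := enum_valP j.
pose A : 'M[rat]_(#|I|, #|X|) := \matrix_(i, j) (U (enum_val i) (v j))%:~R.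
have fullA : row_full A.
  rewrite /row_full -mxrank_tr -[_ == _]/(row_free A^T).
  apply: inj_row_free => w wA; apply/rowP => j; rewrite mxE.
  pose x u := w 0 (enum_rank_in (vX j) u).
  have xv k : x (v k) = w 0 k by rewrite /x enum_valK_in.
  rewrite -xv; apply: freeX (vX j) => i; rewrite big_enum_val.
  have /rowP/(_ (enum_rank i)) := wA; rewrite !mxE => E0; rewrite -[RHS]E0.
  by apply: eq_bigr => k _; rewrite -/(v k) xv !mxE enum_rankK.
pose r i := enum_val (fullrankfun fullA i).
have r_inj : injective r by apply: inj_comp; [apply: enum_val_inj|apply: fullrankfun_inj].
pose B0 : 'M[int]_#|X| := \matrix_(i, j) U (r i) (v j).
pose B : 'M[rat]_#|X| := map_mx intr B0.
have dB : \det B0 != 0.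
  have := fullrowsub_unit fullA; rewrite unitmxE unitfE.
  rewrite (_ : rowsub _ A = B) ?det_map_mx ?intr_eq0 //.
  by apply/matrixP=> i j; rewrite !mxE.
have tuB : \det B0 \in [:: 0; 1; -1] by apply: tuU => //; apply: enum_val_inj.
have yv j : y (v j) \in [:: 0; 1; -1].
  (* Column j of B0 is replaced by column e. *)
  pose Bj : 'M[int]_#|X| := \matrix_(i, k) U (r i) (if k == j then e else v k).
  have tuBj : \det Bj \in [:: 0; 1; -1].
    apply: (tuU _ r (fun k => if k == j then e else v k)) => // k l /=.
    case: (eqVneq k j) => [->|_]; case: (eqVneq l j) => [->|_] //.
    - by move=> ev; move: eX; rewrite ev vX.
    - by move=> ev; move: eX; rewrite -ev vX.
    - exact: enum_val_inj.
  have cramer : (\det B0)%:~R * y (v j) = - (\det Bj)%:~R.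
    pose Y : 'cV[rat]_#|X| := \col_k y (v k).
    have -> : (\det B0)%:~R * y (v j) = (\adj B *m (B *m Y)) j 0.
      by rewrite mulmxA mul_adj_mx det_map_mx mul_scalar_mx !mxE.
    rewrite (expand_det_col Bj j) rmorph_sum -sumrN mxE; apply: eq_bigr => i _.
    have -> : (B *m Y) i 0 = - (U (r i) e)%:~R.
      rewrite -yU big_enum_val mxE; apply: eq_bigr => k _.
      by rewrite !mxE mulrC.
    rewrite mulrN mulrC rmorphM !mxE eqxx; congr (- (_ * _)).
    rewrite cofactor_map_mx; congr (_ %:~R); rewrite /cofactor; congr (_ * \det _).
    by apply/matrixP => k l; rewrite !mxE eq_sym (negPf (neq_lift _ _)).
  move: tuB cramer tuBj; rewrite !inE (negPf dB) /=.
  by case/orP=> /eqP-> yE /or3P[] /eqP dj; move: yE;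
    rewrite dj ?rmorphN ?rmorph0 ?rmorph1 ?mulN1r ?mul1r ?oppr0 ?opprK => /eqP;
    rewrite ?eqr_oppLR ?oppr0 ?opprK => /eqP->.
pose c := [ffun x => if y x == 1 then 1 else if y x == -1 then -1 else 0 : int].
have cE x : (c x)%:~R = y x.
  suff : y x \in [:: 0; 1; -1].
    by rewrite ffunE !inE => /or3P[] /eqP->.
  have [->|xe] := eqVneq x e; first by rewrite ye.
  have [xX|xX] := boolP (x \in X); last by rewrite y0 // in_setU1 negb_or xe.
  by rewrite -(enum_rankK_in xX xX) -/(v _).
have cP : c \in chains U.
  apply/forallP => i; rewrite -(intr_eq0 rat) rmorph_sum.
  rewrite (bigID [in e |: X]) /= addrC big1 ?add0r.
    rewrite big_setU1 //= intrM cE ye mulr1 addrC addr_eq0 -yU.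
    by apply/eqP; apply: eq_bigr => x _; rewrite intrM cE mulrC.
  by move=> x xX; rewrite intrM cE y0 // mulr0.
exists (Chain cP); split=> [|x xX|x] /=; last by rewrite ffunE; do 2?case: ifP.
  by rewrite ffunE ye.
by rewrite ffunE y0.
Qed.

Definition mrank (E : finType) (M : matroid E) (F : {set E}) : nat :=
  (\max_(X in indep M | X \subset F) #|X|)%N.

(** Inclusion-maximal independent subsets have maximal cardinality, by
augmentation. *)
Lemma card_maxset_mrank (E : finType) (M : matroid E) (F B : {set E}) :
  maxset [pred X | (X \in indep M) && (X \subset F)] B -> #|B| = mrank M F.
Proof.
case/maxsetP=> /andP[/= indB sBF] maxB; apply/eqP; rewrite eqn_leq.
apply/andP; split; first by rewrite /mrank (bigop.bigmax_sup B) ?indB.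
apply/bigop.bigmax_leqP => X /andP[indX sXF]; rewrite leqNgt; apply/negP => ltBX.
have [y /setDP[yX yB] indy] := indep_augment indB indX ltBX.
move: yB; rewrite -(maxB (y |: B)) /= ?setU11 ?subsetUr ?indy //=.
by rewrite subUset sub1set (subsetP sXF) ?sBF.
Qed.

Lemma maxset_dep (E : finType) (M : matroid E) (F B : {set E}) (e : E) :
  maxset [pred X | (X \in indep M) && (X \subset F)] B ->
  e \in F -> e \notin B -> e |: B \notin indep M.
Proof.
case/maxsetP=> /andP[/= indB sBF] maxB eF; apply: contraNN => inde.
by rewrite -(maxB (e |: B)) /= ?setU11 ?subsetUr ?inde // subUset sub1set eF.
Qed.

Lemma mem_csupp (I E : finType) (U : I -> E -> int) (c : chain U) e :
  (e \in csupp c) = (c e != 0).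
Proof. by rewrite inE. Qed.

Lemma chain_out (I E : finType) (U : I -> E -> int) (c : chain U) (F : {set E}) e :
  csupp c \subset F -> e \notin F -> c e = 0.
Proof.
move=> sF eF; apply/eqP; rewrite -[_ == _]negbK -mem_csupp.
by apply: contra eF; apply: (subsetP sF).
Qed.

Lemma csuppP (I E : finType) (U : I -> E -> int) (c : chain U) (F : {set E}) :
  (forall e, e \notin F -> c e = 0) -> csupp c \subset F.
Proof.
move=> c0; apply/subsetP => e; rewrite mem_csupp; apply: contraNT => /c0 ->.
exact: eqxx.
Qed.

Lemma dependent_chain (I E : finType) (U : I -> E -> int) (Y : {set E}) :
  totally_unimodular U -> Y \notin column_indep U ->
  exists2 c : chain U, c != 0 & csupp c \subset Y.
Proof.
move=> tuU depY; pose P := [pred X | (X \in column_indep U) && (X \subset Y)].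
have [B maxB _] : {B | maxset P B & set0 \subset B}.
  by apply: maxset_exists; rewrite /= column_indep0 sub0set.
have /andP[/= indB sBY] := maxsetp maxB.
have [e eY eB] : exists2 e, e \in Y & e \notin B.
  apply/subsetPn; apply: contra depY => sYB.
  by rewrite (_ : Y = B) //; apply/eqP; rewrite eqEsubset sYB.
have depe := @maxset_dep E (column_matroid U) Y B e maxB eY eB.
have [c [ce c0 _]] := fundamental_chain tuU indB eB depe.
exists c; first by apply: contra_eq_neq ce => ->; rewrite chain0.
apply: csuppP => x xY; rewrite c0 //.
apply: contra xY; rewrite in_setU1 => /predU1P[->//|]; exact: subsetP.
Qed.

(** A chain g supported inside the support of c is a multiple of c: the difference
g - g(e) c is supported in the independent set X. *)
Lemma fundamental_elementary (I E : finType) (U : I -> E -> int) (X : {set E})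
    (e : E) (c : chain U) :
  X \in column_indep U -> c e = 1 -> (forall x, x \notin e |: X -> c x = 0) ->
  elementary c.
Proof.
move=> indX ce c0; split=> [|g gn0].
  by apply: contra_eq_neq ce => ->; rewrite chain0.
apply/negP => /properP[/subsetP sgc [y yc yg]].
have gE : g = c *~ g e.
  apply/eqP; rewrite -subr_eq0; apply/eqP/(chain_indep_eq0 indX) => x xX.
  rewrite chainD chainN chainMz.
  have [->|xe] := eqVneq x e; first by rewrite ce mul1r subrr.
  have cx : c x = 0 by rewrite c0 // in_setU1 negb_or xe.
  rewrite cx mul0r subr0; apply/eqP; rewrite -[_ == _]negbK -mem_csupp.
  by apply: contraTN isT => /sgc; rewrite mem_csupp cx.
have ge : g e != 0 by apply: contraNneq gn0 => ge; rewrite gE ge mulr0z.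
by move: yc yg; rewrite !mem_csupp gE chainMz mulf_eq0 (negPf ge) orbF => ->.
Qed.

Lemma elementary_circuit (I E : finType) (U : I -> E -> int) (c : chain U) :
  totally_unimodular U -> elementary c -> circuit (column_matroid U) (csupp c).
Proof.
move=> tuU [cn0 minc]; apply/minsetP; split=> [|Y depY sYc].
  apply: contraNN cn0 => indc; apply/eqP/(chain_indep_eq0 indc) => e.
  by rewrite mem_csupp negbK => /eqP.
have [g gn0 sgY] := dependent_chain tuU depY.
apply/eqP; rewrite eqEsubset sYc; apply: contraNT (minc g gn0) => ncY.
by rewrite properE (subset_trans sgY) //; apply: contra ncY => /subset_trans; apply.
Qed.

(** Inclusion-exclusion: expand the product of the factors 1 - [bad e t]. *)
Lemma sieve (T E : finType) (S : {set T}) (bad : E -> pred T) :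
  #|[set t in S | [forall e, ~~ bad e t]]|%:R =
  \sum_(F : {set E}) (-1) ^+ #|F| * #|[set t in S | [forall e in F, bad e t]]|%:R :> int.
Proof.
have cardE (P : pred T) : #|[set t in S | P t]|%:R = \sum_(t in S) (P t)%:R :> int.
  rewrite -sum1_card natr_sum [RHS](bigID P) /= [X in _ + X]big1 ?addr0.
    by apply: eq_big => [t|t]; rewrite inE // => /andP[_ ->].
  by move=> t /andP[_ /negPf->].
have forallE (P : pred E) : [forall e, P e]%:R = \prod_e (P e)%:R :> int.
  have [/forallP allP|/forallPn[e /negPf Pe]] := boolP [forall e, P e].
    by rewrite big1 // => e _; rewrite allP.
  by rewrite (bigD1 e) //= Pe mul0r.
rewrite cardE; under eq_bigr => t _.
  rewrite forallE; under eq_bigr => e _.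
    rewrite (_ : (~~ _)%:R = - (bad e t)%:R + 1 :> int); last by case: bad.
    over.
  rewrite bigA_distr; over.
rewrite exchange_big; apply: eq_bigr => F _; rewrite cardE big_distrr.
apply: eq_bigr => t _ /=; rewrite forallE -prodr_const [X in _ = X * _]big_mkcond -[RHS]big_split.
by apply: eq_bigr => e _ /=; case: ifP; rewrite ?mulN1r ?mulr1.
Qed.

(** * Assigning polynomials of regular matroids *)

Definition mcompatible (E : finType) (M : matroid E) (alpha : massigning M)
    (F : {set E}) : bool :=
  [forall C : mcircuit M, (val C \subset F) ==> ~~ alpha C].

(** The matroid analogue of tau. *)
Definition kochol_poly (E : finType) (M : matroid E) (alpha : massigning M) :
    {poly int} :=
  \sum_(F : {set E} | mcompatible alpha F)
     (-1) ^+ #|F| *: 'X^(mrank M setT - mrank M F).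

Lemma primitive_psi_eq0 (I E : finType) (U : I -> E -> int) (A : finZmodType)
    (psi : {additive chain U -> A}) (F : {set E}) (c : chain U) :
  totally_unimodular U -> mcompatible (induced_assigning (column_matroid U) psi) F ->
  primitive c -> csupp c \subset F -> psi c = 0.
Proof.
move=> tuU /forallP compF primc scF.
have circc : circuit (column_matroid U) (csupp c).
  by apply: elementary_circuit => //; case: primc.
have := compF (exist _ (csupp c) circc); rewrite /= scF /=.
apply: contraNeq => psic; apply/asboolP; exists c; split=> //.
Qed.

(** Let B be a basis of M extending a basis BF of F.  The fundamental chains c e,
e outside B, generate the chain group, so a solution is given by arbitrary values
on B and one equation for each e outside B, which determines its value there.
Being zero on F means being zero on BF and, for e in F outside B, that
psi (c e) = 0, because c e then lives on e |: BF. *)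
Lemma card_solutions_vanishing (I E : finType) (U : I -> E -> int) (A : finZmodType)
    (psi : {additive chain U -> A}) (F : {set E}) (M := column_matroid U) :
  totally_unimodular U ->
  #|[set g : {ffun E -> A} | `[< forall c : chain U, \sum_e g e *~ c e = psi c >]
                             & [forall e in F, g e == 0]]| =
  (if mcompatible (induced_assigning M psi) F
   then #|A| ^ (mrank M setT - mrank M F) else 0)%N.
Proof.
move=> tuU; case: ifP => [compF|/forallPn[C]]; last first.
  rewrite negb_imply negbK => /andP[sCF /asboolP[c [primc suppc psic]]].
  apply/eqP; rewrite cards_eq0; apply/eqP/setP=> g; rewrite !inE.
  apply/negP => /andP[/asboolP/(_ c) gc /forallP g0].
  move: psic; rewrite -gc big1 ?eqxx // => e _.
  have [ec|] := boolP (e \in csupp c).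
    have eF : e \in F by apply: (subsetP sCF); rewrite -suppc.
    by rewrite (eqP (implyP (g0 e) eF)) mul0rz.
  by rewrite mem_csupp negbK => /eqP->; rewrite mulr0z.
pose indF := [pred X | (X \in indep M) && (X \subset F)].
have [BF maxBF _] : {B | maxset indF B & set0 \subset B}.
  by apply: maxset_exists; rewrite /= column_indep0 sub0set.
have /andP[/= indBF sBFF] := maxsetp maxBF.
pose indE := [pred X | (X \in indep M) && (X \subset [set: E])].
have [B maxB sBFB] : {B | maxset indE B & BF \subset B}.
  by apply: maxset_exists; rewrite /= indBF subsetT.
have /andP[/= indB _] := maxsetp maxB.
have BF_B e : e \in F -> e \in B -> e \in BF.
  move=> eF eB; apply: contraT => eBF.
  have := maxset_dep maxBF eF eBF; rewrite (@indepS _ M _ B _ indB) //.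
  by rewrite subUset sub1set eB.
have exc e : exists c : chain U, e \notin B ->
    [/\ c e = 1, forall x, x \notin e |: B -> c x = 0 & e \in F ->
       psi c = 0 /\ forall x, x \notin e |: BF -> c x = 0].
  have [eB|eB] := boolP (e \in B); first by exists 0.
  have [eF|eF] := boolP (e \in F); last first.
    have [c [ce c0 _]] := fundamental_chain tuU indB eB (maxset_dep maxB (in_setT e) eB).
    by exists c.
  have eBF : e \notin BF by apply: contra eB; apply: subsetP.
  have [c [ce c0 cv]] := fundamental_chain tuU indBF eBF (maxset_dep maxBF eF eBF).
  exists c => _; split=> // [x xB|_].
    by rewrite c0 //; apply: contra xB; apply/subsetP; rewrite setUS.
  split=> //; apply: (@primitive_psi_eq0 _ _ _ _ _ F) => //.
    by split=> //; apply: fundamental_elementary indBF ce c0.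
  apply/subsetP => x; rewrite mem_csupp; apply: contraNT => xF; rewrite c0 //.
  by apply: contra xF; rewrite in_setU1 => /predU1P[->//|]; apply: subsetP.
have [c cP] := fin_all_exists exc.
(* Both sides agree outside the independent set B. *)
have genc (f : chain U) : f = \sum_(e | e \notin B) c e *~ f e.
  apply/eqP; rewrite -subr_eq0; apply/eqP/(chain_indep_eq0 indB) => x xB.
  rewrite chainD chainN chain_sum (bigD1 x) //= chainMz.
  have [-> _ _] := cP x xB; rewrite mul1r big1 ?addr0 ?subrr // => e /andP[eB xe].
  have [_ c0 _] := cP e eB.
  by rewrite chainMz c0 ?mul0r // in_setU1 negb_or eq_sym xe.
rewrite -(card_maxset_mrank maxB) -(card_maxset_mrank maxBF) -cardsDS //.
rewrite -(card_pffun_on 0 (B :\: BF) predT).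
pose res (g : {ffun E -> A}) := [ffun e => if e \in B then g e else 0].
(* The value at e outside B is forced by the equation of the chain c e. *)
pose ext (h : {ffun E -> A}) :=
  [ffun e => if e \in B then h e else psi (c e) - \sum_(b in B) h b *~ c e b].
have sumc (g : {ffun E -> A}) e : e \notin B ->
    \sum_x g x *~ c e x = g e + \sum_(b in B) g b *~ c e b.
  move=> eB; have [ce c0 _] := cP e eB.
  rewrite (bigD1 e) //= ce; congr (_ + _).
  rewrite (bigID [in B]) /= [X in _ + X]big1 ?addr0; last first.
    by move=> x /andP[xe xB]; rewrite c0 ?mulr0z // in_setU1 negb_or xe.
  by apply: eq_bigl => b; case: eqVneq eB => // ->; case: (e \in B).
rewrite -(card_in_imset (f := res)); last first.
  move=> g1 g2; rewrite !inE => /andP[/asboolP g1P _] /andP[/asboolP g2P _] /ffunP eqg.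
  have eqB b : b \in B -> g1 b = g2 b by move=> bB; have := eqg b; rewrite !ffunE bB.
  apply/ffunP => e; have [/eqB//|eB] := boolP (e \in B).
  have := g1P (c e); rewrite -g2P !sumc //.
  by rewrite (eq_bigr _ (fun b bB => congr1 (fun a => a *~ c e b) (eqB b bB))) => /addIr.
apply: eq_card => h; apply/imsetP/pffun_onP => [[g + ->]|[/subsetP supph _]].
  rewrite inE => /andP[_ /forallP g0]; split=> //; apply/subsetP => e.
  rewrite !inE ffunE; case: ifP; last by rewrite eqxx.
  move=> eB; rewrite andbT; apply: contraNN => eBF.
  by have := g0 e; rewrite (subsetP sBFF).
have h0 e : e \notin B :\: BF -> h e = 0.
  by move=> eB; apply/eqP; apply: contraNT eB => he; apply: supph.
exists (ext h); last first.
  apply/ffunP => e; rewrite !ffunE; have [//|eB] := boolP (e \in B).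
  by rewrite h0 // in_setD (negPf eB) andbF.
rewrite inE; apply/andP; split; last first.
  apply/forallP => e; apply/implyP => eF; rewrite ffunE; case: ifP => eB.
    by rewrite h0 // in_setD BF_B.
  have [_ _ /(_ eF)[-> c0]] := cP e (negbT eB).
  rewrite sub0r oppr_eq0 big1 // => b bB.
  have [bBF|bBF] := boolP (b \in BF); first by rewrite h0 ?mul0rz // in_setD bBF.
  rewrite c0 ?mulr0z // in_setU1 negb_or bBF andbT.
  by apply: contraFneq eB => <-.
apply/asboolP => f; rewrite [in RHS](genc f) raddf_sum.
have fE x : f x = \sum_(e | e \notin B) c e x * f e.
  by rewrite [in LHS](genc f) chain_sum; apply: eq_bigr => e _; rewrite chainMz.
under eq_bigr => x _ do rewrite fE mulrz_sumr.
rewrite exchange_big /=; apply: eq_bigr => e eB; rewrite raddfMz.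
under eq_bigr => x _ do rewrite mulrzA.
rewrite -mulrz_suml; congr (_ *~ _); rewrite sumc // [ext h e]ffunE (negPf eB).
rewrite [X in _ + X](eq_bigr (fun b => h b *~ c e b)) ?subrK // => b bB.
by rewrite ffunE bB.
Qed.

(** Kochol's theorem: sieve over the set where a solution vanishes; each term of
the sieve only depends on the matroid and on the assigning. *)
Lemma assigning_polyP (E : finType) (M : matroid E) (alpha : massigning M) :
  is_assigning_poly alpha (kochol_poly alpha).
Proof.
move=> I U tuU eqM; subst M => A psi alphaE.
have compE F : mcompatible (induced_assigning (column_matroid U) psi) F = mcompatible alpha F.
  by apply: eq_forallb => C; rewrite alphaE.
pose S := [set g : {ffun E -> A} | `[< forall c : chain U, \sum_e g e *~ c e = psi c >]].
have -> : nz_solutions psi = [set g in S | [forall e, ~~ (g e == 0)]].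
  by apply/setP => g; rewrite !inE andbC.
rewrite (sieve S (fun e (g : {ffun E -> A}) => g e == 0)) horner_sum big_mkcond.
apply: eq_bigr => F _.
have -> : [set g in S | [forall e in F, g e == 0]] = 
   [set g : {ffun E -> A} | `[< forall c : chain U, \sum_e g e *~ c e = psi c >]
                             & [forall e in F, g e == 0]].
  by apply/setP => g; rewrite !inE.
rewrite card_solutions_vanishing // compE; case: ifP; last by rewrite mulr0.
by rewrite hornerZ hornerXn natrX.
Qed.

(** * Components of spanning subgraphs *)

Lemma set2_inj (T : finType) (a b u v : T) :
  [set a; b] = [set u; v] -> (a = u /\ b = v) \/ (a = v /\ b = u).
Proof.
move=> E; have /set2P[au|av] : a \in [set u; v] by rewrite -E set21.
  left; split=> //; have /set2P[bu|//] : b \in [set u; v] by rewrite -E set22.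
  have /set2P[->|->//] : v \in [set a; b] by rewrite E set22.
  by rewrite bu.
right; split=> //; have /set2P[//|bv] : b \in [set u; v] by rewrite -E set22.
have /set2P[->|->//] : u \in [set a; b] by rewrite E set21.
by rewrite bv.
Qed.

Lemma adjP (G : mgraph) (D : orientation G) (F : {set edge G}) u v :
  reflect (exists d, [/\ d.1 \in F, dtail D d = u & dhead D d = v]) (adj F u v).
Proof.
apply: (iffP existsP) => [[e /andP[eF /eqP]]|[[e b] [/= eF <- <-]]].
  rewrite (orientationP D) => /set2_inj[[tu hv]|[tv hu]].
    by exists (e, true).
  by exists (e, false).
by exists e; rewrite eF (orientationP D) /dtail /dhead; case: b; rewrite //= setUC.
Qed.

Lemma adj_sym (G : mgraph) (F : {set edge G}) : symmetric (adj F).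
Proof. by move=> u v; apply: eq_existsb => e; rewrite setUC. Qed.

Lemma connect_adj_sym (G : mgraph) (F : {set edge G}) : connect_sym (adj F).
Proof. exact/sym_connect_sym/adj_sym. Qed.

Lemma adj_subset (G : mgraph) (F F' : {set edge G}) u v :
  F \subset F' -> adj F u v -> adj F' u v.
Proof.
move=> /subsetP sF /existsP[e /andP[/sF eF uv]].
by apply/existsP; exists e; rewrite eF.
Qed.

Lemma connect_subset (G : mgraph) (F F' : {set edge G}) u v :
  F \subset F' -> connect (adj F) u v -> connect (adj F') u v.
Proof.
by move=> sF; apply: connect_sub => x y /(adj_subset sF); apply: connect1.
Qed.

Lemma connect_ends (G : mgraph) (D : orientation G) (F : {set edge G}) e :
  e \in F -> connect (adj F) (tail D e) (head D e).
Proof. by move=> eF; apply/connect1/(adjP D); exists (e, true). Qed.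

Definition locally_constant (G : mgraph) (T : finType) (F : {set edge G}) :
    {set {ffun vertex G -> T}} :=
  [set c : {ffun vertex G -> T} | [forall u, forall v, adj F u v ==> (c u == c v)]].

Lemma locally_constantP (G : mgraph) (T : finType) (F : {set edge G})
    (c : {ffun vertex G -> T}) :
  reflect (forall u v, connect (adj F) u v -> c u = c v) (c \in locally_constant T F).
Proof.
rewrite inE; apply: (iffP forallP) => [cP u v /connectP[p]|cP u].
  elim: p u => [u _ ->//|w p IH u /= /andP[uw pw] vE].
  by rewrite (eqP (implyP (forallP (cP u) w) uw)) (IH w).
by apply/forallP => v; apply/implyP => uv; rewrite (cP u v) ?connect1.
Qed.

(** This count is how component numbers are compared below: with T = bool, an
identity between numbers of locally constant functions is an identity between
component numbers. *)
Lemma card_locally_constant (G : mgraph) (T : finType) (t0 : T) (F : {set edge G}) :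
  #|locally_constant T F| = (#|T| ^ ncomp F)%N.
Proof.
pose R := [pred v | roots (adj F) v].
have -> : ncomp F = #|R| by apply: eq_card => v; rewrite !inE andbT.
rewrite -(card_pffun_on t0 R predT).
pose res (c : {ffun vertex G -> T}) := [ffun v => if R v then c v else t0].
have Rroot v : R (fingraph.root (adj F) v) by exact: (roots_root (connect_adj_sym F)).
rewrite -(card_in_imset (f := res)); last first.
  move=> c1 c2 /locally_constantP c1P /locally_constantP c2P /ffunP E.
  apply/ffunP => v; rewrite (c1P _ _ (connect_root (adj F) v)).
  rewrite (c2P _ _ (connect_root (adj F) v)).
  by have := E (fingraph.root (adj F) v); rewrite !ffunE Rroot.
apply: eq_card => h; apply/imsetP/pffun_onP => [[c cP ->]|[/subsetP supph _]].
  split=> //; apply/subsetP => v; rewrite !inE ffunE.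
  by case: ifP => // ; rewrite eqxx.
exists [ffun v => h (fingraph.root (adj F) v)].
  apply/locally_constantP => u v uv; rewrite !ffunE; congr (h _).
  exact/(fingraph.rootP (connect_adj_sym F)).
apply/ffunP => v; rewrite !ffunE; case: ifP => [/eqP->//|/negP Rv].
by apply/eqP; apply: contraT => /supph.
Qed.

Lemma mem_locally_constant (G : mgraph) (D : orientation G) (T : finType)
    (F : {set edge G}) (c : {ffun vertex G -> T}) :
  (c \in locally_constant T F) = [forall x in F, c (tail D x) == c (head D x)].
Proof.
apply/idP/forall_inP => [/locally_constantP cP x xF|cP].
  by rewrite (cP _ _ (connect_ends D xF)).
rewrite inE; apply/forallP => u; apply/forallP => v; apply/implyP => /(adjP D).
by case=> -[x []] [/= xF <- <-]; rewrite /dtail /dhead /= (eqP (cP x xF)).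
Qed.

Lemma locally_constant_setU1 (G : mgraph) (D : orientation G) (T : finType)
    (F : {set edge G}) (e : edge G) (c : {ffun vertex G -> T}) :
  (c \in locally_constant T (e |: F)) =
  (c \in locally_constant T F) && (c (tail D e) == c (head D e)).
Proof.
rewrite !(mem_locally_constant D); apply/forall_inP/andP => [cP|[/forall_inP cF ce] x].
  by split; [apply/forall_inP => x xF|]; apply: cP; rewrite in_setU1 ?eqxx ?xF ?orbT.
by rewrite in_setU1 => /predU1P[->|/cF].
Qed.

Lemma ncomp_locally_constant (G H : mgraph) (F : {set edge G}) (F' : {set edge H}) :
  #|locally_constant bool F| = #|locally_constant bool F'| -> ncomp F = ncomp F'.
Proof.
rewrite !(card_locally_constant true) card_bool; exact: expnI.
Qed.

Lemma ncomp_subset (G : mgraph) (F F' : {set edge G}) :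
  F \subset F' -> (ncomp F' <= ncomp F)%N.
Proof.
move=> sF; rewrite -(@leq_exp2l 2) // -card_bool -!(card_locally_constant true).
apply/subset_leq_card/subsetP => c /locally_constantP cP.
by apply/locally_constantP => u v uv; apply/cP/(connect_subset sF uv).
Qed.

Lemma ncomp0 (G : mgraph) : @ncomp G set0 = #|vertex G|.
Proof.
apply/(@expnI 2) => //; rewrite -card_bool -(card_locally_constant true) -card_ffun.
apply: eq_card => c; rewrite !inE; apply/forallP => u; apply/forallP => v.
by apply/implyP => /existsP[e]; rewrite inE.
Qed.

Lemma ncomp_le (G : mgraph) (F : {set edge G}) : (ncomp F <= #|vertex G|)%N.
Proof. by rewrite -ncomp0 ncomp_subset ?sub0set. Qed.

Lemma ncomp_connected (G : mgraph) (D : orientation G) (F : {set edge G}) e :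
  connect (adj F) (tail D e) (head D e) -> ncomp (e |: F) = ncomp F.
Proof.
move=> con; apply: ncomp_locally_constant; apply: eq_card => c.
rewrite (locally_constant_setU1 D); apply: andb_idr => /locally_constantP cP.
by rewrite (cP _ _ con).
Qed.

(** Flipping a boolean function on the component of one end of e exchanges the
functions that agree at the ends of e with those that do not, so exactly half of
the functions that are constant on the components of F survive in e |: F. *)
Lemma ncomp_disconnected (G : mgraph) (D : orientation G) (F : {set edge G}) e :
  ~~ connect (adj F) (tail D e) (head D e) -> ncomp F = (ncomp (e |: F)).+1.
Proof.
move=> dis; apply/(@expnI 2) => //; rewrite expnS.
rewrite -card_bool -!(card_locally_constant true).
pose flip (c : {ffun vertex G -> bool}) :=
  [ffun v => c v (+) connect (adj F) (tail D e) v].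
have flipK : involutive flip by move=> c; apply/ffunP => v; rewrite !ffunE addbK.
have flipP c : c \in locally_constant bool F -> flip c \in locally_constant bool F.
  move=> /locally_constantP cP; apply/locally_constantP => u v uv; rewrite !ffunE.
  by rewrite (cP u v uv) (same_connect_r (connect_adj_sym F) uv).
have flip_e c : (flip c (tail D e) == flip c (head D e)) = (c (tail D e) != c (head D e)).
  by rewrite !ffunE connect0 (negPf dis); case: (c _); case: (c _).
rewrite -(cardsID (locally_constant bool (e |: F)) (locally_constant bool F)).
rewrite card_bool mul2n -addnn; congr (_ + _)%N.
  apply: eq_card => c; rewrite in_setI (locally_constant_setU1 D).
  by rewrite andbA andbb.
rewrite -[RHS](card_imset (mem (locally_constant bool (e |: F))) (inv_inj flipK)).
apply: eq_card => c.
rewrite in_setD; apply/andP/imsetP => [[ce cF]|[c' c'P ->]].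
  exists (flip c); rewrite ?flipK // (locally_constant_setU1 D) flipP //.
  by move: ce; rewrite (locally_constant_setU1 D) cF flip_e.
move: c'P; rewrite (locally_constant_setU1 D) => /andP[c'F c'e].
rewrite (locally_constant_setU1 D _ _ (flip c')) flip_e c'e andbF /=.
by split; last exact: flipP.
Qed.

(** * Cycles and chains of a graph *)

(** Chains are orthogonal to potential differences: exchange the sums over edges
and vertices. *)
Lemma pairing_coboundary (G : mgraph) (D : orientation G) (A : zmodType)
    (p : vertex G -> A) (c : Gamma D) :
  \sum_e (p (head D e) - p (tail D e)) *~ c e = 0.
Proof.
have pE e : p (head D e) - p (tail D e) = \sum_v p v *~ incidence D v e.
  have delta w : p w = \sum_v p v *~ (w == v)%:R.
    rewrite (bigD1 w) //= eqxx mulr1z big1 ?addr0 // => v vw.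
    by rewrite eq_sym (negPf vw).
  by rewrite [in LHS](delta (head D e)) [in LHS](delta (tail D e)) -sumrB;
    apply: eq_bigr => v _; rewrite /incidence mulrzBr.
under eq_bigr => e _ do rewrite pE mulrz_suml.
rewrite exchange_big big1 // => v _ /=.
under eq_bigr => e _ do rewrite -mulrzA.
by rewrite -mulrz_sumr chainE.
Qed.

(** Each dart of the walk contributes a signed unit; the boundary of the sum counts
heads minus tails. *)
Lemma walk_chain (G : mgraph) (D : orientation G) (W : seq (edge G * bool)) :
  uniq [seq d.1 | d <- W] ->
  perm_eq [seq dhead D d | d <- W] [seq dtail D d | d <- W] ->
  exists c : Gamma D, (forall e, (c e != 0) = (e \in [seq d.1 | d <- W])) /\
    forall e, c e \in [:: 0; 1; -1].
Proof.
move=> uW bW; pose sgn (d : edge G * bool) : int := if d.2 then 1 else -1.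
pose c := [ffun e => \sum_(d <- W) (d.1 == e)%:R * sgn d].
have cP : c \in chains (incidence D).
  apply/forallP => v; apply/eqP.
  under eq_bigr => e _ do rewrite ffunE big_distrr.
  rewrite exchange_big /=.
  have E d : \sum_e incidence D v e * ((d.1 == e)%:R * sgn d) =
             (dhead D d == v)%:R - (dtail D d == v)%:R.
    rewrite (bigD1 d.1) //= eqxx mul1r big1 ?addr0 => [|e /negPf ne]; last first.
      by rewrite eq_sym ne mul0r mulr0.
    by rewrite /incidence /sgn /dhead /dtail; case: d.2; rewrite ?mulr1 ?mulrN1 ?opprB.
  under eq_bigr => d _ do rewrite E.
  rewrite sumrB; apply/eqP; rewrite subr_eq0 -(big_map (dhead D) xpredT (fun u => (u == v)%:R)).
  by rewrite (perm_big _ bW) big_map.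
exists (Chain cP); split=> e /=.
  have [/mapP[d dW ->]|eW] := boolP (e \in _).
    move: uW; rewrite ffunE; elim: W dW {bW c cP} => //= d' W IH.
    rewrite in_cons big_cons => /predU1P[-> /andP[dW _]|dW /andP[d'W uW]].
      rewrite eqxx mul1r big_seq big1 ?addr0 => [|x xW]; last first.
        rewrite (_ : (x.1 == d'.1) = false) ?mul0r //.
        by apply: contraNF dW => /eqP<-; apply: map_f.
      by rewrite /sgn; case: ifP.
    rewrite (_ : (d'.1 == d.1) = false) ?mul0r ?add0r; first exact: IH.
    by apply: contraNF d'W => /eqP->; apply: map_f.
  rewrite ffunE big_seq big1 ?eqxx // => d dW; rewrite (_ : (d.1 == e) = false) ?mul0r //.
  by apply: contraNF eW => /eqP<-; apply: map_f.
rewrite ffunE; elim: W uW {bW c cP} => [|d W IH] /=; first by rewrite big_nil.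
case/andP=> dW uW; rewrite big_cons; have [<-|_] := eqVneq; last by rewrite mul0r add0r IH.
rewrite mul1r big_seq big1 ?addr0 => [|x xW]; first by rewrite /sgn; case: ifP.
by rewrite (_ : (x.1 == d.1) = false) ?mul0r //; apply: contraNF dW => /eqP<-; apply: map_f.
Qed.

(** In this form a loop contributes 2 without a case distinction. *)
Lemma degreeE (G : mgraph) (D : orientation G) (F : {set edge G}) v :
  degree F v = (\sum_(e in F) ((head D e == v) + (tail D e == v)))%N.
Proof.
rewrite /degree big_mkcondr; apply: eq_bigr => e _.
rewrite /is_loop (orientationP D) cards2 in_set2 ![v == _]eq_sym.
case: (eqVneq (tail D e) (head D e)) => [->|ne] /=; first by case: eqP.
by case: (eqVneq (tail D e) v) ne => [->|_]; case: (eqVneq (head D e) v) => // -> /eqP.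
Qed.

Lemma mem_vset (G : mgraph) (D : orientation G) (F : {set edge G}) v :
  reflect (exists2 d, d.1 \in F & dhead D d = v) (v \in vset F).
Proof.
apply: (iffP bigcupP) => [[e eF]|[[e b] /= eF <-]].
  by rewrite (orientationP D) => /set2P[->|->]; [exists (e, false)|exists (e, true)].
by exists e; rewrite // (orientationP D) /dhead; case: b; rewrite !inE eqxx ?orbT.
Qed.

(** The edges are distinct because the vertices are: the first edge contains u,
and no later edge does. *)
Lemma dart_path (G : mgraph) (D : orientation G) (F : {set edge G}) u p :
  path (adj F) u p -> uniq (u :: p) ->
  exists w : seq (edge G * bool),
    [/\ [seq dhead D d | d <- w] = p, [seq dtail D d | d <- w] = belast u p,
        uniq [seq d.1 | d <- w], {subset [seq d.1 | d <- w] <= F} &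
        path (adj [set:: [seq d.1 | d <- w]]) u p].
Proof.
elim: p u => [|x p IH] u /=; first by exists [::].
case/andP=> /(adjP D)[d [dF du dx]] /IH{}IH /andP[up /IH[w [wp wb uw wF wpath]]].
exists (d :: w); split=> /=; rewrite ?wp ?wb ?uw ?andbT ?dx ?du //.
- apply: contra up => /mapP[d' d'w dd'].
  have : u \in [set dtail D d'; dhead D d'].
    rewrite -du; move: dd'; case: (d) (d') => [e b] [e' b'] /= <-.
    by case: b; case: b'; rewrite /dtail /dhead !inE eqxx ?orbT.
  case/set2P=> ->; last by rewrite -wp in_cons map_f ?orbT.
  by apply: mem_belast; rewrite -wb map_f.
- by move=> e /[!in_cons] /predU1P[->//|/wF].
apply/andP; split; first by apply/(adjP D); exists d; rewrite !inE eqxx.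
apply: sub_path wpath => a b; apply: adj_subset.
by apply/subsetP => e; rewrite !inE => ->; rewrite orbT.
Qed.

(** Close a simple path in F joining the ends of e by e itself.  Along the
resulting walk both the heads and the tails run once through the vertices, so
every degree is 2; for a loop the path is empty. *)
Lemma cycle_through_edge (G : mgraph) (D : orientation G) (F : {set edge G}) e :
  connect (adj F) (tail D e) (head D e) -> e \notin F ->
  exists K : {set edge G},
    [/\ is_cycle K, e \in K, K \subset e |: F &
        exists2 c : Gamma D, csupp c = K & forall x, c x \in [:: 0; 1; -1]].
Proof.
rewrite connect_adj_sym => /connectP[p0 /shortenP[p pp up _] lastp] eF.
have [w [wp wb uw wF wpath]] := dart_path D pp up.
pose W := (e, true) :: w.
have headW : [seq dhead D d | d <- W] = head D e :: p by rewrite /= wp.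
have tailW : [seq dtail D d | d <- W] = tail D e :: belast (head D e) p by rewrite /= wb.
have uW : uniq [seq d.1 | d <- W] by rewrite /= uw andbT; apply: contra eF => /wF.
have bW : perm_eq [seq dhead D d | d <- W] [seq dtail D d | d <- W].
  by rewrite headW tailW lastI -lastp perm_rcons.
pose K := [set:: [seq d.1 | d <- W]].
exists K; split.
- have vK v : v \in vset K -> v \in [seq dhead D d | d <- W].
    case/(mem_vset D) => d; rewrite inE => /mapP[d' d'W dd'] <-.
    have : dhead D d \in [set dtail D d'; dhead D d'].
      move: dd'; case: (d) (d') => [x b] [x' b'] /= <-.
      by case: b; case: b'; rewrite /dtail /dhead !inE eqxx ?orbT.
    by case/set2P=> ->; [rewrite (perm_mem bW)|]; apply: map_f.
  apply/and3P; split.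
  + by apply/set0Pn; exists e; rewrite !inE eqxx.
  + apply/forallP => v; apply/implyP => /vK vW.
    rewrite (degreeE D) (eq_bigl (mem [seq d.1 | d <- W])) => [|x]; last by rewrite inE.
    rewrite -big_uniq // big_map.
    have uh : uniq [seq dhead D d | d <- W] by rewrite headW.
    have ut : uniq [seq dtail D d | d <- W] by rewrite -(perm_uniq bW).
    have sum_mem (q : edge G * bool -> vertex G) : uniq [seq q d | d <- W] ->
        (\sum_(d <- W) (q d == v) = (v \in [seq q d | d <- W]))%N.
      move=> uq; rewrite -count_uniq_mem // -sum1_count big_map [RHS]big_mkcond.
      by apply: eq_bigr => d _ /=; case: eqP.
    rewrite (eq_bigr (fun d => (dhead D d == v) + (dtail D d == v))%N); last first.
      by move=> [x []] _; rewrite /dhead /dtail //= addnC.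
    by rewrite big_split /= !sum_mem // -(perm_mem bW) vW.
  have path_K : path (adj K) (head D e) p.
    apply: sub_path wpath => a b; apply: adj_subset.
    by apply/subsetP => x; rewrite !inE => ->; rewrite orbT.
  have conK v : v \in vset K -> connect (adj K) (head D e) v.
    by move/vK; rewrite headW; apply: path_connect.
  apply/forallP => u; apply/implyP => /conK; rewrite connect_adj_sym => uK.
  by apply/forallP => v; apply/implyP => /conK; apply: connect_trans.
- by rewrite !inE eqxx.
- by apply/subsetP => x; rewrite !inE => /predU1P[->|/wF->]; rewrite ?eqxx ?orbT.
have [c [cW cv]] := walk_chain uW bW.
by exists c => //; apply/setP => x; rewrite !inE cW.
Qed.

(** At a vertex of the cycle that meets the support, conservation forbids that
exactly one of the two incident edges carries a nonzero value.  So the support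
contains all edges of C at its vertices, and C is connected. *)
Lemma csupp_cycle (G : mgraph) (D : orientation G) (C : {set edge G}) (g : Gamma D) :
  is_cycle C -> g != 0 -> csupp g \subset C -> csupp g = C.
Proof.
case/and3P=> _ /forall_inP deg2 /forall_inP con gn0 sgC.
(* The contribution of the edge e to the degree of v, see degreeE. *)
pose w v e := ((head D e == v) + (tail D e == v))%N.
have sV : vset (csupp g) \subset vset C.
  apply/subsetP => v /(mem_vset D)[d dg dv]; apply/(mem_vset D).
  by exists d => //; apply: (subsetP sgC).
have w_dart d : (0 < w (dhead D d) d.1)%N.
  by case: d => e []; rewrite /w /dhead /= eqxx // addn1.
have full v y : v \in vset (csupp g) -> y \in C -> (0 < w v y)%N -> y \in csupp g.
  move=> vg yC wy; have /eqP := deg2 _ (subsetP sV _ vg); rewrite (degreeE D) -/(w v).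
  case/(mem_vset D): vg => d dg dv; set x := d.1 in dg.
  have wx : (0 < w v x)%N by rewrite -dv w_dart.
  apply: contra_eqT => yg; have yx : y != x by apply: contraNneq yg => ->.
  have xC : x \in C by apply: (subsetP sgC).
  rewrite (bigD1 x) //= (bigD1 y) /=; last by rewrite yC.
  apply/eqP => sum2.
  move: sum2; rewrite -/(w v x) -/(w v y); set S := (\sum_(_ | _) _)%N => sum2.
  have wx1 : w v x = 1%N by lia.
  have : S = 0%N by lia.
  move/eqP; rewrite sum_nat_eq0 => /forallP w0.
  have := chainE g v; rewrite (bigD1 x) //= big1 ?addr0 => [/eqP|e ex].
    rewrite mulf_eq0 /incidence; move: dg; rewrite mem_csupp => /negPf->.
    by move: wx1; rewrite /w; case: eqP; case: eqP.
  have [eC|eC] := boolP (e \in C); last first.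
    rewrite (_ : g e = 0) ?mulr0 //; apply/eqP; rewrite -[_ == _]negbK -mem_csupp.
    by apply: contra eC; apply: (subsetP sgC).
  have [->|ey] := eqVneq e y.
    by move: yg; rewrite mem_csupp negbK => /eqP->; rewrite mulr0.
  have := w0 e; rewrite eC ex ey /= /incidence.
  by case: (head D e == v); case: (tail D e == v); rewrite ?subrr ?mul0r.
have closed u v : connect (adj C) u v -> u \in vset (csupp g) -> v \in vset (csupp g).
  case/connectP=> p; elim: p u => [u _ ->//|z p IH u /= /andP[uz zp] vE ug].
  apply: IH zp vE _; case/(adjP D): uz => d [dC du dz].
  apply/(mem_vset D); exists d => //; apply: (full u) => //.
  by rewrite -du /w /dtail; case: (d) => x []; rewrite /= eqxx // addn1.
have [x gx] : exists x, g x != 0.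
  apply/existsP; apply: contraR gn0 => /existsPn g0.
  by apply/eqP/chain_eq0 => e; apply/eqP; rewrite -[_ == _]negbK g0.
have hx : head D x \in vset (csupp g).
  by apply/(mem_vset D); exists (x, true); rewrite // mem_csupp.
apply/eqP; rewrite eqEsubset sgC; apply/subsetP => e eC.
apply: (full (head D e)) => //; last by rewrite /w eqxx.
apply: (closed _ _ _ (hx)); apply: (forall_inP (con _ (subsetP sV _ hx))).
by apply/(mem_vset D); exists (e, true).
Qed.

(** The difference of the two sides vanishes at x, hence everywhere by
[csupp_cycle]. *)
Lemma cycle_chains_proportional (G : mgraph) (D : orientation G) (C : {set edge G})
    (g h : Gamma D) x :
  is_cycle C -> csupp g \subset C -> csupp h \subset C -> x \in C ->
  g *~ h x = h *~ g x.
Proof.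
move=> cycC sg sh xC; apply/eqP; rewrite -subr_eq0; apply: contraTT xC => dn0.
rewrite -(csupp_cycle cycC dn0); last first.
  apply: csuppP => e eC.
  by rewrite chainD chainN !chainMz (chain_out sg eC) (chain_out sh eC) !mul0r subrr.
by rewrite mem_csupp negbK chainD chainN !chainMz mulrC subrr.
Qed.

(** Otherwise the indicator of the component of the tail of e in the rest of the
support is a potential whose difference pairs with c to plus or minus c e. *)
Lemma chain_connects (G : mgraph) (D : orientation G) (c : Gamma D) e :
  c e != 0 -> connect (adj (csupp c :\ e)) (tail D e) (head D e).
Proof.
move=> ce; apply: contraR ce => dis; apply/eqP.
pose p v : int := (connect (adj (csupp c :\ e)) (tail D e) v)%:R.
have := pairing_coboundary p c; rewrite (bigD1 e) //= big1 ?addr0 => [|x xe].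
  by rewrite /p connect0 (negPf dis) sub0r mulNrz => /eqP; rewrite oppr_eq0 intz => /eqP.
have [->|cx] := eqVneq (c x) 0; first by rewrite mulr0z.
have xF : x \in csupp c :\ e by rewrite in_setD1 xe mem_csupp.
by rewrite /p (same_connect_r (connect_adj_sym _) (connect_ends D xF)) subrr mul0rz.
Qed.

Lemma cycle_in_support (G : mgraph) (D : orientation G) (c : Gamma D) e :
  c e != 0 -> exists K, [/\ is_cycle K, e \in K, K \subset csupp c &
    exists2 k : Gamma D, csupp k = K & forall x, k x \in [:: 0; 1; -1]].
Proof.
move=> ce; have [|K [cycK eK sK kP]] := cycle_through_edge (chain_connects ce).
  by rewrite in_setD1 eqxx.
by exists K; split=> //; rewrite setD1K ?mem_csupp // in sK.
Qed.

(** Induction on the support: a cycle through an edge e of the support has a chain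
with value 1 or -1 at e, so an integral multiple of it cancels c at e. *)
Lemma chain_ind_cycles (G : mgraph) (D : orientation G) (F : {set edge G})
    (P : Gamma D -> Prop) :
  P 0 -> (forall a b n, P a -> P b -> P (a + b *~ n)) ->
  (forall K k, is_cycle K -> K \subset F -> csupp k = K ->
     (forall x, k x \in [:: 0; 1; -1]) -> P k) ->
  forall c, csupp c \subset F -> P c.
Proof.
move=> P0 Plin Pcyc c; have [n] := ubnP #|csupp c|.
elim: n c => // n IH c; rewrite ltnS => cn sc.
have [->//|cn0] := eqVneq c 0.
have [e ce] : exists e, c e != 0.
  apply/existsP; apply: contraR cn0 => /existsPn c0.
  by apply/eqP/chain_eq0 => e; apply/eqP; rewrite -[_ == _]negbK c0.
have [K [cycK eK sK [k kK kv]]] := cycle_in_support ce.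
have ke : k e * k e = 1.
  have /negPf k0 : k e != 0 by rewrite -mem_csupp kK.
  by have := kv e; rewrite !inE k0 /= => /orP[] /eqP->.
rewrite -(subrK (k *~ (c e * k e)) c).
have sd : csupp (c - k *~ (c e * k e)) \subset csupp c :\ e.
  apply: csuppP => x; rewrite in_setD1 negb_and negbK chainD chainN chainMz.
  case/predU1P=> [->|xc]; first by rewrite mulrCA ke mulr1 subrr.
  by rewrite (chain_out (subxx _) xc) (_ : k x = 0) ?mul0r ?subr0 // (chain_out _ xc) ?kK.
apply: Plin.
  apply: IH (subset_trans sd _); last by apply: subset_trans (subsetDl _ _) sc.
  apply: leq_ltn_trans (subset_leq_card sd) _.
  by move: cn; rewrite (cardsD1 e (csupp c)) mem_csupp ce.
by apply: (Pcyc K) => //; apply: subset_trans sK sc.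
Qed.

(** * Compatible subgraphs and tensions *)

Lemma pairing_lin (I E : finType) (U : I -> E -> int) (A : zmodType) (f : E -> A)
    (a b : chain U) (n : int) :
  \sum_e f e *~ (a + b *~ n) e = \sum_e f e *~ a e + (\sum_e f e *~ b e) *~ n.
Proof.
rewrite mulrz_suml -big_split; apply: eq_bigr => e _ /=.
by rewrite chainD chainMz mulrzDr mulrzA.
Qed.

Lemma pairing_vanishes (G : mgraph) (D : orientation G) (A : zmodType)
    (f : edge G -> A) (F : {set edge G}) :
  (forall K k, is_cycle K -> K \subset F -> csupp k = K ->
     (forall x, k x \in [:: 0; 1; -1]) -> \sum_e f e *~ (k : Gamma D) e = 0) ->
  forall c : Gamma D, csupp c \subset F -> \sum_e f e *~ c e = 0.
Proof.
apply: chain_ind_cycles => [|a b n a0 b0].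
  by rewrite big1 // => e _; rewrite chain0 mulr0z.
by rewrite pairing_lin a0 b0 mul0rz addr0.
Qed.

(** Build the potential edge by edge.  If the new edge e closes a cycle, the chain
of that cycle forces the right difference at e; if not, shift the potential on
the component of the head of e. *)
Lemma balancedP (G : mgraph) (D : orientation G) (A : zmodType)
    (f : edge G -> A) (F : {set edge G}) :
  (forall c : Gamma D, csupp c \subset F -> \sum_e f e *~ c e = 0) <->
  (exists p : vertex G -> A, forall e, e \in F -> f e = p (head D e) - p (tail D e)).
Proof.
split=> [|[p fp] c sc]; last first.
  rewrite -[RHS](pairing_coboundary p c); apply: eq_bigr => e _.
  by have [/fp->//|eF] := boolP (e \in F); rewrite (chain_out sc eF) !mulr0z.
have [n] := ubnP #|F|; elim: n F => // n IH F; rewrite ltnS => Fn f0.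
have [F0|/set0Pn[e eF]] := eqVneq F set0.
  by exists (fun=> 0) => e; rewrite F0 inE.
have [||p fp] := IH (F :\ e).
- by move: Fn; rewrite (cardsD1 e F) eF.
- by move=> c sc; apply: f0; apply: subset_trans sc (subsetDl _ _).
have [con|dis] := boolP (connect (adj (F :\ e)) (tail D e) (head D e)).
  exists p => x xF; have [->|xe] := eqVneq x e; last by apply: fp; rewrite !inE xe.
  have [|K [_ eK sK [k kK kv]]] := cycle_through_edge con; first by rewrite !inE eqxx.
  rewrite setD1K // in sK; have sk : csupp k \subset F by rewrite kK.
  have := etrans (f0 k sk) (esym (pairing_coboundary p k)).
  rewrite (bigD1 e) //= [RHS](bigD1 e) //=.
  rewrite [X in _ + X](eq_bigr (fun x => (p (head D x) - p (tail D x)) *~ k x)); last first.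
    move=> y ye; have [yF|yF] := boolP (y \in F); first by rewrite fp // !inE ye.
    by rewrite (chain_out sk yF) !mulr0z.
  move/addIr; have /negPf k0 : k e != 0 by rewrite -mem_csupp kK.
  by have := kv e; rewrite !inE k0 /= => /orP[] /eqP->; rewrite ?mulrNz ?mulr1z // => /oppr_inj.
pose q v := p v + (if connect (adj (F :\ e)) (head D e) v
                   then f e - (p (head D e) - p (tail D e)) else 0).
exists q => x xF; rewrite /q; have [->|xe] := eqVneq x e.
  rewrite connect0 (connect_adj_sym _ (head D e)) (negPf dis) addr0.
  by rewrite [p (head D e) + (_ - _)]addrC -addrA subrK.
have xF' : x \in F :\ e by rewrite !inE xe.
rewrite (same_connect_r (connect_adj_sym _) (connect_ends D xF')).
by set s := if _ then _ else _; rewrite opprD addrACA subrr addr0; apply: fp.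
Qed.

Lemma mem_eta (G : mgraph) (D : orientation G) (o : directions D) (C : gcycle G) e :
  (eta o C e != 0) = (e \in val C).
Proof.
rewrite -(walk_edges (o C)) ffunE; apply/idP/mapP => [|[[x b] xb ->]].
  by case: ifP => [et _|_]; [exists (e, true)|case: ifP => // ef _; exists (e, false)].
by case: ifP => //= xt; case: ifP => // xf; move: xb; case: b; rewrite ?xt ?xf.
Qed.

Lemma csupp_eta (G : mgraph) (D : orientation G) (o : directions D) (C : gcycle G) :
  csupp (eta_chain o C) = val C.
Proof. by apply/setP => e; rewrite mem_csupp mem_eta. Qed.

Lemma assigning_ofE (G : mgraph) (D : orientation G) (o : directions D)
    (A : finZmodType) (f : edge G -> A) (C : gcycle G) :
  assigning_of o f C = (\sum_e f e *~ eta_chain o C e != 0).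
Proof.
rewrite /assigning_of big_mkcond; congr (_ != 0); apply: eq_bigr => e _ /=.
by rewrite -(mem_eta o C); case: eqP => //= ->; rewrite mulr0z.
Qed.

Lemma eta_sign (G : mgraph) (D : orientation G) (o : directions D) (C : gcycle G) e :
  eta_chain o C e \in [:: 0; 1; -1].
Proof. by rewrite ffunE; do 2?case: ifP. Qed.

Lemma cycle_chain_eta (G : mgraph) (D : orientation G) (o : directions D)
    (C : gcycle G) (k : Gamma D) :
  csupp k \subset val C -> exists n : int, k = eta_chain o C *~ n.
Proof.
move=> sk; have [e eC] : exists e, e \in val C.
  by apply/set0Pn; case/and3P: (valP C).
have /negPf e0 : eta_chain o C e != 0 by rewrite mem_eta.
exists (k e * eta_chain o C e).
rewrite mulrzA -(@cycle_chains_proportional _ D (val C) k) ?csupp_eta //; last exact: valP.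
by rewrite -mulrzA; have := eta_sign o C e; rewrite !inE e0 /= => /orP[] /eqP->.
Qed.

(** The assigning tests only cycles, but the chains of the cycles inside F generate
all chains supported in F. *)
Lemma compatible_vanishes (G : mgraph) (D : orientation G) (o : directions D)
    (A : finZmodType) (f : edge G -> A) (alpha : gassigning G) (F : {set edge G}) :
  alpha =1 assigning_of o f ->
  compatible alpha F <->
  (forall c : Gamma D, csupp c \subset F -> \sum_e f e *~ c e = 0).
Proof.
move=> alphaE; split=> [/forallP compF|f0].
  apply: pairing_vanishes => K k cycK sK kK _.
  pose C : gcycle G := exist _ K cycK.
  have := compF C; rewrite alphaE assigning_ofE /= sK negbK => /eqP C0.
  have [n ->] : exists n, k = eta_chain o C *~ n by apply: cycle_chain_eta; rewrite kK.
  rewrite -[eta_chain o C *~ n]add0r pairing_lin C0 mul0rz addr0.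
  by rewrite big1 // => e _; rewrite chain0 mulr0z.
apply/forallP => C; apply/implyP => sC.
by rewrite alphaE assigning_ofE f0 ?eqxx // csupp_eta.
Qed.

Lemma grank_sub (G : mgraph) (F : {set edge G}) :
  (grank [set: edge G] - grank F = ncomp F - ncomp [set: edge G])%N.
Proof.
have := ncomp_le F; have := ncomp_subset (subsetT F).
by rewrite /grank; lia.
Qed.

Definition potentials (G : mgraph) (D : orientation G) (A : finZmodType)
    (f : edge G -> A) (F : {set edge G}) : {set {ffun vertex G -> A}} :=
  [set p : {ffun vertex G -> A} | [forall e in F, p (head D e) - p (tail D e) == f e]].

(** The potentials form a coset of the functions constant on the components of F. *)
Lemma card_potentials (G : mgraph) (D : orientation G) (A : finZmodType)
    (f : edge G -> A) (F : {set edge G}) p0 :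
  p0 \in potentials D f F -> #|potentials D f F| = (#|A| ^ ncomp F)%N.
Proof.
rewrite inE => /forall_inP p0P.
rewrite -(card_locally_constant (0 : A) F).
rewrite -[RHS](card_imset (mem (locally_constant A F)) (addrI p0)).
apply: eq_card => p; rewrite inE; apply/forall_inP/imsetP => [pP|[c cP -> e eF]].
  exists (p - p0); last by rewrite addrC subrK.
  rewrite inE; apply/forallP => u; apply/forallP => v; apply/implyP => /(adjP D).
  case=> -[e b] [/= eF <- <-]; have := eqP (pP e eF); rewrite -(eqP (p0P e eF)).
  move=> E; have {}E : (p - p0) (head D e) = (p - p0) (tail D e).
    rewrite !ffunE; apply/eqP; rewrite -subr_eq0 opprB.
    by rewrite [p0 _ - p _]addrC addrACA E addrACA subrr addNr addr0.
  by case: b; rewrite /dtail /dhead /= E.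
rewrite !ffunE (locally_constantP _ _ cP _ _ (connect_ends D eF)).
by rewrite opprD addrACA subrr addr0 p0P.
Qed.

(** Sort the potentials of f on F by the tension they define; each fibre is a coset
of the functions constant on the components of G. *)
Lemma card_tensions (G : mgraph) (D : orientation G) (o : directions D)
    (A : finZmodType) (f : edge G -> A) (alpha : gassigning G) (F : {set edge G}) :
  alpha =1 assigning_of o f ->
  #|[set t : {ffun edge G -> A} | tension D t & [forall e in F, t e == f e]]| =
  (if compatible alpha F
   then #|A| ^ (grank [set: edge G] - grank F) else 0)%N.
Proof.
move=> alphaE; set T := [set t | _].
pose d (p : {ffun vertex G -> A}) := [ffun e => p (head D e) - p (tail D e)].
have TE t : (t \in T) = (t \in d @: potentials D f F).
  apply/idP/imsetP; rewrite inE.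
    case/andP=> /existsP[p /forallP tp] /forall_inP tf; exists p.
      by rewrite inE; apply/forall_inP => e eF; rewrite -(eqP (tp e)) tf.
    by apply/ffunP => e; rewrite ffunE (eqP (tp e)).
  case=> p; rewrite inE => /forall_inP pf ->; apply/andP; split.
    by apply/existsP; exists p; apply/forallP => e; rewrite ffunE.
  by apply/forall_inP => e eF; rewrite ffunE pf.
rewrite (eq_card TE); case: ifP => [|/negP ncF]; last first.
  apply/eqP; rewrite cards_eq0 imset_eq0; apply/negPn/negP => /set0Pn[p].
  rewrite inE => /forall_inP pf; apply/ncF/(compatible_vanishes F alphaE).
  by apply/balancedP; exists p => e /pf/eqP.
case/(compatible_vanishes F alphaE)/balancedP => p pf.
have p0P : [ffun v => p v] \in potentials D f F.
  by rewrite inE; apply/forall_inP => e eF; rewrite !ffunE pf.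
have A0 : (0 < #|A|)%N by apply/card_gt0P; exists 0.
apply/eqP; rewrite -(@eqn_pmul2r (#|A| ^ ncomp [set: edge G])) ?expn_gt0 ?A0 //.
rewrite -expnD grank_sub subnK ?ncomp_subset ?subsetT // -(card_potentials p0P).
rewrite -[X in _ == X]sum1_card (partition_big_imset d) -sum_nat_const /=.
apply/eqP/eq_bigr => t /imsetP[q qP tq].
have qE : q \in potentials D t [set: edge G].
  by rewrite inE; apply/forall_inP => e _; rewrite tq ffunE.
rewrite -(card_potentials qE) -sum1_card; apply: eq_bigl => r.
rewrite [in LHS]inE; apply/forall_inP/andP => [rP|[rF /eqP <-] e _]; last by rewrite ffunE.
have dr : d r = t by apply/ffunP => e; rewrite ffunE (eqP (rP e _)) ?in_setT.
split; last by apply/eqP.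
move: qP; rewrite !inE => /forall_inP qP; apply/forall_inP => e eF.
by rewrite -(eqP (qP e eF)); have /ffunP/(_ e) := etrans dr tq; rewrite !ffunE => ->.
Qed.

Lemma tau_Delta (G : mgraph) (D : orientation G) (o : directions D)
    (A : finZmodType) (f : edge G -> A) (alpha : gassigning G) :
  alpha =1 assigning_of o f -> (tau alpha).[#|A|%:R] = #|Delta D f|%:R.
Proof.
move=> alphaE; pose S := [set t : {ffun edge G -> A} | tension D t].
have -> : Delta D f = [set t in S | [forall e, ~~ (t e == f e)]].
  by apply/setP => t; rewrite !inE.
rewrite (sieve S (fun e (t : {ffun edge G -> A}) => t e == f e)) horner_sum big_mkcond.
apply: eq_bigr => F _.
have -> : [set t in S | [forall e in F, t e == f e]] =
    [set t : {ffun edge G -> A} | tension D t & [forall e in F, t e == f e]].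
  by apply/setP => t; rewrite !inE.
rewrite (card_tensions F alphaE); case: ifP; last by rewrite mulr0.
by rewrite hornerZ hornerXn natrX.
Qed.

(** Expand a square submatrix along a column with nonzero sum: it has a single
nonzero entry, since exactly one end of the edge is among the rows.  If all
column sums are zero, the rows add up to zero. *)
Lemma incidence_tu (G : mgraph) (D : orientation G) :
  totally_unimodular (incidence D).
Proof.
elim=> [|n IH] r c r_inj c_inj; first by rewrite det_mx00.
set M := \matrix_(i, j) _.
have Msum j : \sum_i M i j = (head D (c j) \in codom r)%:R - (tail D (c j) \in codom r)%:R.
  under eq_bigr => i _ do rewrite mxE.
  have delta v : \sum_i (v == r i)%:R = (v \in codom r)%:R :> int.
    have [/codomP[i ->]|vr] := boolP (v \in codom r).
      rewrite (bigD1 i) //= eqxx big1 ?addr0 // => k ki.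
      by rewrite (inj_eq r_inj) eq_sym (negPf ki).
    rewrite big1 // => i _; rewrite (_ : _ == _ = false) //.
    by apply: contraNF vr => /eqP->; apply: codom_f.
  by rewrite sumrB !delta.
have [/forallP sum0|/forallPn[j]] := boolP [forall j, \sum_i M i j == 0].
  suff -> : \det M = 0 by rewrite inE.
  apply/eqP/det0P; exists (const_mx 1).
    by apply/eqP => /rowP/(_ ord0)/eqP; rewrite !mxE oner_eq0.
  apply/rowP => j; rewrite [RHS]mxE -[RHS](eqP (sum0 j)) mxE.
  by apply: eq_bigr => i _; rewrite mxE mul1r.
have tri (a b : int) : a \in [:: 0; 1; -1] -> b \in [:: 0; 1; -1] ->
    a * b \in [:: 0; 1; -1].
  by rewrite !inE => /or3P[] /eqP-> /or3P[] /eqP->.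
have cof i : cofactor M i j \in [:: 0; 1; -1].
  apply: tri; first by rewrite -signr_odd; case: odd.
  rewrite (_ : row' _ _ = \matrix_(k, l) incidence D (r (lift i k)) (c (lift j l))).
    by apply: IH; apply: inj_comp; [| exact: lift_inj | | exact: lift_inj].
  by apply/matrixP => k l; rewrite !mxE.
suff H : \sum_i M i j != 0 -> exists i, forall k, k != i -> M k j = 0.
  case/H=> i Mi; rewrite (expand_det_col M j) (bigD1 i) //= big1 ?addr0 => [|k /Mi->].
    apply: tri; last exact: cof.
    by rewrite mxE /incidence; case: (_ == _); case: (_ == _).
  by rewrite mul0r.
rewrite Msum.
have out v k : v \notin codom r -> (v == r k) = false.
  by move=> vr; apply: contraNF vr => /eqP->; apply: codom_f.
have [/codomP[i hi]|hr] := boolP (head D (c j) \in codom r);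
  have [/codomP[l tl]|tr] := boolP (tail D (c j) \in codom r); rewrite ?subrr ?eqxx // => _.
  exists i => k /negPf ki; rewrite mxE /incidence hi (out _ _ tr).
  by rewrite (inj_eq r_inj) eq_sym ki subrr.
exists l => k /negPf kl; rewrite mxE /incidence tl (out _ _ hr).
by rewrite (inj_eq r_inj) eq_sym kl subrr.
Qed.

(** * The assigning polynomial of the cycle matroid *)

Lemma psi_pairing (G : mgraph) (D : orientation G) (o : directions D)
    (A : finZmodType) (f : edge G -> A) (psi : {additive chain (incidence D) -> A}) :
  (forall C, psi (eta_chain o C) = - \sum_e f e *~ eta o C e) ->
  forall c : Gamma D, psi c = - \sum_e f e *~ c e.
Proof.
move=> psi_eta c; have lin (a b : Gamma D) (n : int) : psi a = - \sum_e f e *~ a e ->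
    psi b = - \sum_e f e *~ b e -> psi (a + b *~ n) = - \sum_e f e *~ (a + b *~ n) e.
  by move=> psia psib; rewrite pairing_lin raddfD raddfMz psia psib opprD mulNrz.
have psi0 : psi 0 = - \sum_e f e *~ (0 : Gamma D) e.
  by rewrite raddf0 big1 ?oppr0 // => e _; rewrite chain0 mulr0z.
pose P (c : Gamma D) := psi c = - \sum_e f e *~ c e.
apply: (@chain_ind_cycles _ D [set: edge G] P) => //.
move=> K k cycK _ kK _; pose C : gcycle G := exist _ K cycK.
have [n ->] : exists n, k = eta_chain o C *~ n by apply: cycle_chain_eta; rewrite kK.
by rewrite -[_ *~ n]add0r; apply: lin.
Qed.

Lemma tension_pairing (G : mgraph) (D : orientation G) (A : finZmodType)
    (t : {ffun edge G -> A}) :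
  reflect (forall c : Gamma D, \sum_e t e *~ c e = 0) (tension D t).
Proof.
apply: (iffP existsP) => [[p /forallP tp] c|t0].
  by apply: (balancedP D t setT).2 (subsetT _); exists p => e _; apply/eqP.
have [p tp] := (balancedP D t setT).1 (fun c _ => t0 c).
by exists [ffun v => p v]; apply/forallP => e; rewrite !ffunE tp.
Qed.

Lemma card_nz_solutions (G : mgraph) (D : orientation G) (o : directions D)
    (A : finZmodType) (f : edge G -> A) (psi : {additive chain (incidence D) -> A}) :
  (forall C, psi (eta_chain o C) = - \sum_e f e *~ eta o C e) ->
  #|nz_solutions psi| = #|Delta D f|.
Proof.
move=> /psi_pairing psiE; pose ff := [ffun e => f e].
rewrite -[LHS](card_imset _ (addIr ff)); apply: eq_card => t.
have tE (g : {ffun edge G -> A}) : (g + ff \in Delta D f) = (g \in nz_solutions psi).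
  rewrite !inE andbC; congr (_ && _).
    by apply: eq_forallb => e; rewrite !ffunE -subr_eq0 addrK.
  apply/tension_pairing/asboolP => H c; have := H c.
    rewrite psiE => H0; apply/eqP; rewrite -addr_eq0; apply/eqP.
    rewrite -[RHS]H0 -[LHS]big_split /=.
    by apply: eq_bigr => e _; rewrite !ffunE mulrzDl.
  rewrite psiE => /eqP; rewrite -addr_eq0 -big_split => /eqP H0; rewrite -[RHS]H0.
  by apply: eq_bigr => e _; rewrite !ffunE mulrzDl.
apply/imsetP/idP => [[g gP ->]|tP]; first by rewrite tE.
by exists (t - ff); rewrite ?subrK // -tE subrK.
Qed.

HB.instance Definition _ (A B : finZmodType) := Finite.on (A * B)%type.

Definition pair0 (A B : finZmodType) (a : A) : A * B := (a, 0).

Lemma pair0_is_zmod_morphism (A B : finZmodType) : zmod_morphism (@pair0 A B).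
Proof. by move=> a b; rewrite /pair0 -[RHS]/(a - b, 0 - 0) subr0. Qed.

HB.instance Definition _ (A B : finZmodType) :=
  GRing.isZmodMorphism.Build A (A * B)%type (@pair0 A B) (@pair0_is_zmod_morphism A B).

Lemma pair0_eq0 (A B : finZmodType) (a : A) : (pair0 B a == 0) = (a == 0).
Proof. by rewrite -[0]/(0, 0) xpair_eqE eqxx andbT. Qed.

(** Two polynomials that agree at |A| (n + 1) for all n are equal.  The values are
compared through A x Z/(n+1), with f and psi extended by 0. *)
Lemma tau_assigning_poly (G : mgraph) (D : orientation G) (o : directions D)
    (A : finZmodType) (f : edge G -> A) (alpha : gassigning G)
    (psi : {additive chain (incidence D) -> A}) :
  alpha =1 assigning_of o f ->
  (forall C, psi (eta_chain o C) = - \sum_e f e *~ eta o C e) ->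
  tau alpha = assigning_poly (induced_assigning (cycle_matroid D) psi).
Proof.
move=> alphaE psi_eta; set beta := induced_assigning _ _; set q := assigning_poly _.
have qP : is_assigning_poly beta q.
  by apply: classical_sets.xgetPex; exists (kochol_poly beta); apply: assigning_polyP.
have q_tau n : q.[(#|A| * n.+1)%:R] = (tau alpha).[(#|A| * n.+1)%:R].
  pose B : finZmodType := (A * 'I_n.+1)%type.
  pose f' : edge G -> B := fun e => pair0 _ (f e).
  pose psi' : {additive chain (incidence D) -> B} := @pair0 A 'I_n.+1 \o psi.
  have cardB : #|B| = (#|A| * n.+1)%N by rewrite card_prod card_ord.
  have sum_f' c : \sum_e f' e *~ (c : Gamma D) e = pair0 _ (\sum_e f e *~ c e).
    by rewrite raddf_sum; apply: eq_bigr => e _; rewrite raddfMz.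
  have alphaE' : alpha =1 assigning_of o f'.
    by move=> C; rewrite alphaE !assigning_ofE sum_f' pair0_eq0.
  have psi'_eta C : psi' (eta_chain o C) = - \sum_e f' e *~ eta o C e.
    by rewrite -[\sum_e _]/(\sum_e f' e *~ eta_chain o C e) sum_f' /= psi_eta raddfN.
  rewrite -cardB (tau_Delta alphaE') -(card_nz_solutions psi'_eta).
  apply: qP; [exact: incidence_tu|by []|].
  move=> C; apply: asbool_equiv_eq; split=> -[c [primc suppc psic]]; exists c; split=> //.
    by move: psic; rewrite /= pair0_eq0.
  by rewrite /= pair0_eq0.
apply/eqP; rewrite -subr_eq0; apply/eqP; set d := tau alpha - q.
apply: (@roots_geq_poly_eq0 _ _ [seq (#|A| * n.+1)%:R | n <- iota 0 (size d)]).
- by apply/allP => _ /mapP[n _ ->]; rewrite /root hornerD hornerN q_tau subrr.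
- rewrite map_inj_uniq ?iota_uniq // => m n /eqP; rewrite eqr_nat eqn_pmul2l.
    by rewrite eqSS => /eqP.
  by apply/card_gt0P; exists 0.
by rewrite size_map size_iota.
Qed.

(** * Deletion, bridges and loops *)

Lemma gvalE (G : mgraph) (alpha : gassigning G) (C : gcycle G) :
  gval alpha (val C) = alpha C.
Proof. by rewrite /gval valK. Qed.

Lemma gval_cycle (G : mgraph) (alpha : gassigning G) (K : {set edge G}) :
  gval alpha K -> is_cycle K.
Proof. by rewrite /gval; case: insubP. Qed.

Lemma compatibleP (G : mgraph) (alpha : gassigning G) (F : {set edge G}) :
  reflect (forall K, is_cycle K -> K \subset F -> ~~ gval alpha K) (compatible alpha F).
Proof.
apply: (iffP forallP) => [cF K cycK sK|cF C].
  by have := cF (exist _ K cycK); rewrite -gvalE /= sK.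
by apply/implyP => sC; rewrite -gvalE; apply: cF => //; apply: valP.
Qed.

(** The edges of G - e and of G / e, seen in G. *)
Definition lift_edges (G : mgraph) (e : edge G) (F : {set del_edge e}) : {set edge G} :=
  [set val x | x in F].

Lemma mem_lift_edges (G : mgraph) (e : edge G) (F : {set del_edge e}) x :
  (val x \in lift_edges F) = (x \in F).
Proof. by rewrite mem_imset //; apply: val_inj. Qed.

Lemma lift_edges_out (G : mgraph) (e : edge G) (F : {set del_edge e}) :
  e \notin lift_edges F.
Proof. by apply/imsetP => -[x _ ex]; have := valP x; rewrite -ex eqxx. Qed.

Lemma lift_edgesK (G : mgraph) (e : edge G) (K : {set edge G}) :
  lift_edges [set x : del_edge e | val x \in K] = K :\ e.
Proof.
apply/setP => x; rewrite in_setD1; apply/imsetP/andP => [[y + ->]|[xe xK]].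
  by rewrite inE; split=> //; apply: (valP y).
by exists (exist _ x xe); rewrite ?inE.
Qed.

Lemma lift_edgesT (G : mgraph) (e : edge G) :
  lift_edges [set: del_edge e] = [set~ e].
Proof.
rewrite -setTD -lift_edgesK; congr lift_edges.
by apply/setP => x; rewrite !inE.
Qed.

Lemma lift_edgesS (G : mgraph) (e : edge G) (F F' : {set del_edge e}) :
  (lift_edges F \subset lift_edges F') = (F \subset F').
Proof.
apply/idP/idP => [/subsetP sF|]; last exact: imsetS.
by apply/subsetP => x; rewrite -mem_lift_edges => /sF; rewrite mem_lift_edges.
Qed.

Lemma lift_edges_subset (G : mgraph) (e : edge G) (K : {set edge G}) (F : {set del_edge e}) :
  K \subset lift_edges F -> exists2 K' : {set del_edge e}, K = lift_edges K' & K' \subset F.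
Proof.
move=> sK; have KE : K = lift_edges [set x : del_edge e | val x \in K].
  rewrite lift_edgesK; apply/esym/setDidPl; rewrite disjoint_sym disjoints1.
  by apply: contra (lift_edges_out F); apply: (subsetP sK).
by exists [set x : del_edge e | val x \in K]; rewrite // -lift_edgesS -KE.
Qed.

Lemma card_lift_edges (G : mgraph) (e : edge G) (F : {set del_edge e}) :
  #|lift_edges F| = #|F|.
Proof. exact/card_imset/val_inj. Qed.

(** Every edge set is F or e |: F for exactly one set F of edges other than e. *)
Lemma sum_subsets_edge (V : nmodType) (G : mgraph) (e : edge G) (X : {set edge G} -> V) :
  \sum_F X F = \sum_(F : {set del_edge e}) (X (lift_edges F) + X (e |: lift_edges F)).
Proof.
rewrite big_split (bigID (fun F : {set edge G} => e \notin F)) /=; congr (_ + _).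
  rewrite (reindex_onto (@lift_edges G e) (fun F => [set x : del_edge e | val x \in F])) /=.
    apply: eq_bigl => F; rewrite lift_edges_out; apply/eqP/setP => x.
    by rewrite inE mem_lift_edges.
  by move=> F eF; rewrite lift_edgesK; apply/setDidPl; rewrite disjoint_sym disjoints1.
rewrite (reindex_onto (fun F => e |: @lift_edges G e F)
          (fun F => [set x : del_edge e | val x \in F])) /=.
  apply: eq_bigl => F; rewrite setU11; apply/eqP/setP => x.
  by rewrite inE in_setU1 mem_lift_edges (negPf (valP x)).
by move=> F; rewrite negbK => eF; rewrite lift_edgesK setD1K.
Qed.

Lemma adj_del (G : mgraph) (e : edge G) (F : {set edge (gdel e)}) :
  adj F =2 adj (lift_edges F).
Proof.
move=> u v; apply/existsP/existsP => [[x /andP[xF uv]]|[_ /andP[/imsetP[x xF ->] uv]]].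
  by exists (val x); rewrite mem_lift_edges xF.
by exists x; rewrite xF.
Qed.

Lemma ncomp_del (G : mgraph) (e : edge G) (F : {set edge (gdel e)}) :
  ncomp F = ncomp (lift_edges F).
Proof. exact: (eq_n_comp (eq_connect (adj_del F))). Qed.

Lemma ncomp_delT (G : mgraph) (e : edge G) :
  ncomp [set: edge (gdel e)] = ncomp [set~ e].
Proof. by rewrite ncomp_del lift_edgesT. Qed.

(** Vertex set, degrees and adjacency only depend on the edges seen in G. *)
Lemma is_cycle_del (G : mgraph) (e : edge G) (F : {set edge (gdel e)}) :
  is_cycle F = is_cycle (lift_edges F).
Proof.
have vsetE : vset F = vset (lift_edges F).
  by rewrite /vset /lift_edges big_imset //= => x y _ _ /val_inj.
have degE v : degree F v = degree (lift_edges F) v.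
  by rewrite /degree /lift_edges big_imset_cond //= => x y _ _ /val_inj.
rewrite /is_cycle vsetE imset_eq0; congr [&& _, _ & _].
  by apply: eq_forallb => v; rewrite degE.
apply: eq_forallb => u; congr (_ ==> _); apply: eq_forallb => v.
by rewrite (eq_connect (adj_del F)).
Qed.

Lemma compatible_del (G : mgraph) (e : edge G) (alpha : gassigning G)
    (F : {set edge (gdel e)}) :
  compatible (del_assigning e alpha) F = compatible alpha (lift_edges F).
Proof.
have gvalD (K : {set edge (gdel e)}) : is_cycle K ->
    gval (del_assigning e alpha) K = gval alpha (lift_edges K).
  by move=> cycK; rewrite -[K]/(val (exist _ K cycK : gcycle (gdel e))) gvalE.
apply/compatibleP/compatibleP => cF K cycK.
  case/lift_edges_subset=> K' KE sK'; rewrite KE -is_cycle_del in cycK *.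
  by rewrite -gvalD ?cF.
by move=> sK; rewrite gvalD // cF ?lift_edgesS -?is_cycle_del.
Qed.

Lemma tau_mkcond (G : mgraph) (alpha : gassigning G) :
  tau alpha = \sum_(F : {set edge G}) if compatible alpha F
    then (-1) ^+ #|F| *: 'X^(ncomp F - ncomp [set: edge G]) else 0.
Proof.
by rewrite /tau big_mkcond; apply: eq_bigr => F _; rewrite grank_sub.
Qed.

Lemma setU1_setC1 (T : finType) (x : T) : x |: [set~ x] = [set: T].
Proof. by apply/setP => y; rewrite !inE orbN. Qed.

Lemma bridgeE (G : mgraph) (D : orientation G) (e : edge G) :
  bridge e = ~~ connect (adj [set~ e]) (tail D e) (head D e).
Proof.
rewrite /bridge ncomp_delT -(setU1_setC1 e).
have [con|dis] := boolP (connect _ _ _); first by rewrite (ncomp_connected con) ltnn.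
by rewrite (ncomp_disconnected dis) ltnSn.
Qed.

Lemma is_loopE (G : mgraph) (D : orientation G) (e : edge G) :
  is_loop e = (tail D e == head D e).
Proof. by rewrite /is_loop (orientationP D) cards2; case: (tail D e == _). Qed.

(** The chain of a cycle through e connects the ends of e outside e. *)
Lemma bridge_cycle (G : mgraph) (D : orientation G) (o : directions D) (e : edge G)
    (K : {set edge G}) :
  bridge e -> is_cycle K -> e \notin K.
Proof.
rewrite (bridgeE D) => dis cycK; apply: contra dis => eK.
pose C : gcycle G := exist _ K cycK.
have ce : eta_chain o C e != 0 by rewrite mem_eta.
by apply: connect_subset (chain_connects ce); apply/subsetP => x; rewrite !inE => /andP[].
Qed.

(** A cycle through the loop e contains the support of the chain of e alone. *)
Lemma loop_cycle (G : mgraph) (D : orientation G) (e : edge G) :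
  is_loop e -> is_cycle [set e] /\ forall K, is_cycle K -> e \in K -> K = [set e].
Proof.
rewrite (is_loopE D) => /eqP loope.
have con : connect (adj set0) (tail D e) (head D e) by rewrite loope connect0.
have [|E [cycE eE sE [k kE _]]] := cycle_through_edge con; first by rewrite inE.
have {}sE : E = [set e].
  by apply/eqP; rewrite eqEsubset sub1set eE andbT; rewrite setU0 in sE.
rewrite sE in cycE kE; split=> // K cycK eK; rewrite -kE; apply/esym.
apply: csupp_cycle => //; last by rewrite kE sub1set.
by apply: contraTneq (set11 e) => k0; rewrite -kE mem_csupp k0 chain0 eqxx.
Qed.

Lemma compatible_bridge (G : mgraph) (D : orientation G) (o : directions D)
    (alpha : gassigning G) (e : edge G) (F : {set edge G}) :
  bridge e -> compatible alpha (e |: F) = compatible alpha F.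
Proof.
move=> bre; apply/compatibleP/compatibleP => cF K cycK sK; apply: cF => //.
  by apply: subset_trans sK (subsetUr _ _).
apply/subsetP => x xK; have /setU1P[xe|//] := subsetP sK x xK.
by have := bridge_cycle o bre cycK; rewrite -xe xK.
Qed.

Lemma compatible_loop (G : mgraph) (D : orientation G)
    (alpha : gassigning G) (e : edge G) (F : {set edge G}) :
  is_loop e -> compatible alpha (e |: F) = compatible alpha F && ~~ loop_val alpha e.
Proof.
case/(loop_cycle D)=> cyce uniqe; apply/compatibleP/andP => [cF|[/compatibleP cF le] K cycK sK].
  split; last by apply: cF => //; rewrite sub1set setU11.
  by apply/compatibleP => K cycK sK; apply: cF => //; apply: subset_trans sK (subsetUr _ _).
have [/uniqe-> //|eK] := boolP (e \in K); apply: cF => //.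
apply/subsetP => x xK; have := subsetP sK x xK; rewrite in_setU1 => /predU1P[xe|//].
by rewrite -xe xK in eK.
Qed.

Lemma tau_bridge (G : mgraph) (D : orientation G) (o : directions D)
    (alpha : gassigning G) (e : edge G) :
  bridge e -> tau alpha = ('X - 1) * tau (del_assigning e alpha).
Proof.
move=> bre; rewrite !tau_mkcond (sum_subsets_edge e) mulr_sumr; apply: eq_bigr => F _.
rewrite compatible_del (compatible_bridge o) //; case: ifP => _; last by rewrite mulr0 addr0.
have dis := bre; rewrite (bridgeE D) in dis.
have disF : ~~ connect (adj (lift_edges F)) (tail D e) (head D e).
  apply: contra dis; apply: connect_subset; rewrite -lift_edgesT lift_edgesS; exact: subsetT.
rewrite cardsU1 lift_edges_out card_lift_edges add1n ncomp_del ncomp_delT.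
have := @ncomp_subset (gdel e) F setT (subsetT F); rewrite ncomp_delT (ncomp_del F).
rewrite (ncomp_disconnected dis) (ncomp_disconnected disF) setU1_setC1 => ge.
rewrite subSS subSn // [(-1) ^+ _.+1]exprS mulN1r exprS scaleNr -scalerBr -scalerAr; congr (_ *: _).
by rewrite mulrBl mul1r.
Qed.

(** If alpha(e) = 0, then F and e |: F contribute opposite terms; if alpha(e) = 1,
no compatible set contains e. *)
Lemma tau_loop (G : mgraph) (D : orientation G) (alpha : gassigning G) (e : edge G) :
  is_loop e -> tau alpha = (loop_val alpha e)%:R * tau (del_assigning e alpha).
Proof.
move=> le; rewrite !tau_mkcond (sum_subsets_edge e) mulr_sumr; apply: eq_bigr => F _.
rewrite compatible_del (compatible_loop D) //.
have con F' : connect (adj F') (tail D e) (head D e).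
  by rewrite (is_loopE D) in le; rewrite (eqP le) connect0.
rewrite (ncomp_connected (con _)) cardsU1 lift_edges_out card_lift_edges add1n.
rewrite ncomp_del ncomp_delT -(ncomp_connected (con [set~ e])) setU1_setC1.
case: ifP => _; case: (loop_val _ _); rewrite ?mul0r ?mul1r ?addr0 //=.
by rewrite exprS mulN1r scaleNr subrr.
Qed.

(** The terms with e not in F give tau of the deletion; the others form the sum to
be identified with tau of the contraction. *)
Lemma tau_link (G : mgraph) (D : orientation G) (alpha : gassigning G) (e : edge G) :
  ~~ bridge e ->
  tau alpha = tau (del_assigning e alpha) -
    \sum_(F : {set del_edge e}) (if compatible alpha (e |: lift_edges F)
       then (-1) ^+ #|F| *: 'X^(ncomp (e |: lift_edges F) - ncomp [set: edge G]) else 0).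
Proof.
rewrite (bridgeE D) negbK => con; rewrite !tau_mkcond (sum_subsets_edge e) -sumrB.
apply: eq_bigr => F _; rewrite compatible_del ncomp_del ncomp_delT card_lift_edges.
rewrite -(ncomp_connected con) setU1_setC1 cardsU1 lift_edges_out card_lift_edges; congr (_ + _).
by case: ifP => _; rewrite ?oppr0 // exprS mulN1r scaleNr.
Qed.

(** * The degree of tau *)

(** A nonempty compatible F contains a link, hence has fewer components than the
empty subgraph: the term of F = set0 is the only one of maximal degree. *)
Lemma size_tau (G : mgraph) (D : orientation G) (alpha : gassigning G) :
  (forall e, is_loop e -> loop_val alpha e) ->
  size (tau alpha) = (#|vertex G| - ncomp [set: edge G]).+1.
Proof.
move=> loops1; set r := (_ - _)%N; rewrite tau_mkcond (bigD1 set0) //=.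
have -> : compatible alpha set0.
  by apply/compatibleP => K /and3P[K0 _ _]; rewrite subset0 (negPf K0).
rewrite cards0 expr0 scale1r ncomp0 -/r size_polyDl ?size_polyXn // ltnS.
apply: leq_trans (size_sum _ _ _) _; apply/bigop.bigmax_leqP => F Fn0.
case: ifP => [/compatibleP cF|_]; last by rewrite size_poly0.
rewrite -signr_odd; apply: leq_trans (size_scale_leq _ _) _; rewrite size_polyXn.
have [e eF le] : exists2 e, e \in F & ~~ is_loop e.
  apply/exists_inP; apply: contraR Fn0 => /exists_inPn noF.
  apply/eqP/setP => e; rewrite inE; apply/negP => eF.
  have le := noF e eF; rewrite negbK in le.
  have := cF [set e] (loop_cycle D le).1; rewrite sub1set => /(_ eF).
  by rewrite -/(loop_val alpha e) loops1.
have dis : ~~ connect (adj set0) (tail D e) (head D e).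
  apply: contra le => /connectP[[|v p] /=]; first by rewrite (is_loopE D) => _ ->.
  by case/andP=> /existsP[x]; rewrite inE.
have := ncomp_disconnected dis; rewrite setU0 ncomp0 => nV.
have : (ncomp F <= ncomp [set e])%N by apply: ncomp_subset; rewrite sub1set.
have := ncomp_subset (subsetT [set e]); rewrite /r nV; lia.
Qed.

(** * Contraction *)

Section Contraction.
Variables (G : mgraph) (D : orientation G) (e : edge G).
Local Notation H := (gcontr e).

Lemma proj_eq u v : (proj e u == proj e v) = (u == v) || (u \in ends e) && (v \in ends e).
Proof.
rewrite -val_eqE /= /merge; case: ifP => ue; case: ifP => ve; rewrite ?andbF ?orbF /=.
- by rewrite eqxx orbT.
- rewrite (_ : (u == v) = false); last by apply: contraFF ve => /eqP<-.
  by apply: contraFF ve => /eqP->; rewrite set11.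
- rewrite (_ : (u == v) = false); last by apply: contraFF ue => /eqP->.
  by apply: contraFF ue => /eqP<-; rewrite set11.
by apply/eqP/eqP => [/set1_inj|->].
Qed.

Lemma proj_surj (B : vertex H) : exists v, proj e v = B.
Proof. by case: B => B Bp; have /codomP[v Bv] := Bp; exists v; apply: val_inj. Qed.

Lemma contr_orientationP (x : edge H) :
  ends x = [set proj e (tail D (val x)); proj e (head D (val x))].
Proof. by rewrite /= /contr_ends (orientationP D) imsetU1 imset_set1. Qed.

Definition contr_orientation : orientation H := Orientation contr_orientationP.

Local Notation DH := contr_orientation.

Lemma proj_ends : proj e (tail D e) = proj e (head D e).
Proof. by apply/eqP; rewrite proj_eq (orientationP D) set21 set22 orbT. Qed.

Lemma ncomp_contr (F : {set edge H}) : ncomp F = ncomp (e |: lift_edges F).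
Proof.
apply: ncomp_locally_constant.
pose pull (c : {ffun vertex H -> bool}) := [ffun v => c (proj e v)].
have pull_inj : injective pull.
  move=> c1 c2 /ffunP E; apply/ffunP => B; have [v <-] := proj_surj B.
  by have := E v; rewrite !ffunE.
rewrite -[LHS](card_imset _ pull_inj); apply: eq_card => c.
rewrite (locally_constant_setU1 D) (mem_locally_constant D).
apply/imsetP/andP => [[c' + ->]|[/forall_inP cF /eqP ce]].
  rewrite (mem_locally_constant DH) => /forall_inP c'F; split.
    by apply/forall_inP => _ /imsetP[x xF ->]; rewrite !ffunE; apply: c'F.
  by rewrite !ffunE proj_ends.
have c_proj u v : proj e u = proj e v -> c u = c v.
  move/eqP; rewrite proj_eq (orientationP D) !inE => /orP[/eqP->//|].
  by case/andP=> /orP[] /eqP-> /orP[] /eqP->.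
have [s sK] := choice proj_surj.
exists [ffun B => c (s B)]; last by apply/ffunP => v; rewrite !ffunE; apply: c_proj; rewrite sK.
rewrite (mem_locally_constant DH); apply/forall_inP => x xF; rewrite !ffunE.
rewrite (c_proj (s _) (tail D (val x))) ?sK // (c_proj (s _) (head D (val x))) ?sK //.
by apply: cF; rewrite mem_lift_edges.
Qed.

Lemma sum_fiber_delta (B : vertex H) u :
  \sum_(v | proj e v == B) (u == v)%:R = (proj e u == B)%:R :> int.
Proof.
have [uB|uB] := boolP (proj e u == B).
  by rewrite (bigD1 u) //= eqxx big1 ?addr0 // => v /andP[_ /negPf]; rewrite eq_sym => ->.
by rewrite big1 // => v vB; case: (eqVneq u v) uB => // ->; rewrite vB.
Qed.

(** The row of a vertex of G / e is the sum of the rows of the vertices merged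
into it. *)
Lemma incidence_contr (B : vertex H) (x : edge H) :
  incidence DH B x = \sum_(v | proj e v == B) incidence D v (val x).
Proof.
by rewrite /incidence /= sumrB !sum_fiber_delta.
Qed.

Lemma sum_del_edge (V : nmodType) (X : edge G -> V) :
  \sum_x X x = X e + \sum_(x : del_edge e) X (val x).
Proof.
rewrite (bigD1 e) //=; congr (_ + _).
rewrite (eq_bigl (mem (lift_edges [set: del_edge e]))); last first.
  by move=> x; rewrite /= lift_edgesT !inE.
rewrite big_imset /= => [|x y _ _]; last exact: val_inj.
by apply: eq_bigl => x; rewrite inE.
Qed.

(** The edge e has both ends in the same vertex of G / e, so dropping its value
preserves the boundary. *)
Lemma push_chain (g : Gamma D) :
  exists g' : Gamma contr_orientation, forall x, g' x = g (val x).
Proof.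
have g'P : [ffun x : edge H => g (val x)] \in chains (incidence contr_orientation).
  apply/forallP => B; apply/eqP.
  under eq_bigr => x _ do rewrite ffunE incidence_contr mulr_suml.
  rewrite exchange_big /=.
  have sum_v v : \sum_(x : del_edge e) incidence D v (val x) * g (val x) =
      - (incidence D v e * g e).
    by apply/eqP; rewrite -addr_eq0 addrC -(sum_del_edge (fun x => _ * _)) chainE.
  under eq_bigr => v _ do rewrite sum_v.
  rewrite sumrN -mulr_suml.
  have -> : \sum_(v | proj e v == B) incidence D v e = 0.
    by rewrite /incidence sumrB !sum_fiber_delta proj_ends subrr.
  by rewrite mul0r oppr0.
by exists (Chain g'P) => x; rewrite ffunE.
Qed.

(** The boundary in G of a chain of G / e vanishes away from the ends of e, and its
values at the two ends are opposite: a suitable value at e balances both. *)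
Lemma lift_chain (w : Gamma contr_orientation) :
  ~~ is_loop e -> exists g : Gamma D, forall x : edge H, g (val x) = w x.
Proof.
rewrite (is_loopE D) => th.
pose b v := \sum_(x : del_edge e) incidence D v (val x) * w x.
have sum_b B : \sum_(v | proj e v == B) b v = 0.
  rewrite exchange_big -[RHS](chainE w B) /=; apply: eq_bigr => x _.
  by rewrite incidence_contr mulr_suml.
pose g := [ffun y => if insub y is Some x then w x else b (tail D e)].
have gx (x : del_edge e) : g (val x) = w x by rewrite ffunE valK.
have ge : g e = b (tail D e) by rewrite ffunE insubF ?eqxx.
have fiber_e v : (proj e v == proj e (tail D e)) = (v == tail D e) || (v == head D e).
  rewrite proj_eq (orientationP D) !inE eqxx andbT orbA orbb.
  by [].
have gP : g \in chains (incidence D).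
  apply/forallP => v; rewrite (sum_del_edge (fun y => incidence D v y * g y)) ge.
  under eq_bigr => x _ do rewrite gx.
  rewrite -/(b v); have [->|vt] := eqVneq v (tail D e).
    by rewrite /incidence eqxx [head D e == _]eq_sym (negPf th) sub0r mulN1r addNr.
  have [->|vh] := eqVneq v (head D e).
    rewrite /incidence eqxx (negPf th) subr0 mul1r -[X in _ == X](sum_b (proj e (tail D e))).
    rewrite (bigD1 (tail D e)) //= (bigD1 (head D e)) /=; last first.
      by rewrite fiber_e eqxx orbT eq_sym.
    rewrite big1 ?addr0 // => u; rewrite fiber_e.
    by case: (u == tail D e); case: (u == head D e).
  rewrite /incidence ![_ == v]eq_sym (negPf vt) (negPf vh) subrr mul0r add0r.
  rewrite -[X in _ == X](sum_b (proj e v)) (bigD1 v) //= big1 ?addr0 // => u /andP[].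
  rewrite proj_eq (orientationP D) !inE (negPf vt) (negPf vh) andbF orbF => /eqP->.
  by rewrite eqxx.
by exists (Chain gP).
Qed.

Lemma sum_contr (A : zmodType) (f : edge G -> A) (g : Gamma D)
    (g' : Gamma contr_orientation) :
  f e = 0 -> (forall x, g' x = g (val x)) ->
  \sum_y f y *~ g y = \sum_x f (val x) *~ g' x.
Proof.
move=> fe g'E; rewrite (sum_del_edge (fun y => f y *~ g y)) fe mul0rz add0r.
by apply: eq_bigr => x _; rewrite g'E.
Qed.

(** K is found in the support of a lift of a chain k' of K'.  Pushed back to G / e,
the chain of K is supported in K', and a cycle has no smaller support. *)
Lemma contr_cycle (alpha : gassigning G) (K' : {set edge H}) (k' : Gamma contr_orientation) :
  ~~ is_loop e -> is_cycle K' -> csupp k' = K' ->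
  exists K, [/\ is_cycle K, K :\ e = lift_edges K' &
    gval (contr_assigning e alpha) K' = gval alpha K].
Proof.
move=> le cycK' k'K'; have [g gE] := lift_chain k' le.
have -> : gval (contr_assigning e alpha) K' =
    if is_cycle (lift_edges K') then gval alpha (lift_edges K')
    else gval alpha (e |: lift_edges K').
  by rewrite -[K']/(val (exist _ K' cycK' : gcycle H)) gvalE.
have setD1_lift : lift_edges K' :\ e = lift_edges K'.
  by apply/setDidPl; rewrite disjoint_sym disjoints1 lift_edges_out.
case: ifP => [cycL|ncycL]; first by exists (lift_edges K').
have [x xK'] : exists x, x \in K' by apply/set0Pn; case/and3P: cycK'.
have gx : g (val x) != 0 by rewrite gE -mem_csupp k'K'.
have [K [cycK xK sKg [k kK _]]] := cycle_in_support gx.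
have [p pE] := push_chain k.
have KE : K :\ e = lift_edges K'.
  rewrite -lift_edgesK; congr lift_edges.
  rewrite -(csupp_cycle (D := contr_orientation) (g := p) cycK').
  - by apply/setP => y; rewrite inE mem_csupp pE -mem_csupp kK.
  - by apply: contraTneq xK => p0; rewrite -kK mem_csupp -pE p0 chain0 eqxx.
  apply: csuppP => y yK'; rewrite pE; apply: (chain_out (F := K)); first by rewrite kK.
  by apply: contra yK' => /(subsetP sKg); rewrite mem_csupp gE -k'K' mem_csupp.
have eK : e \in K.
  apply: contraFT ncycL => eK; rewrite -KE (_ : K :\ e = K) //.
  by apply/setDidPl; rewrite disjoint_sym disjoints1.
by exists K; split=> //; rewrite -KE setD1K.
Qed.

(** From G / e to G: every chain supported in e |: F restricts to a chain of G / e
with the same pairing with f, and such chains are generated by those of cycles of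
G / e, on which the pairing vanishes because they come from cycles of G with the
same assigning ([contr_cycle]).  From G to G / e: if the contracted assigning is
1 at a cycle in F, then by definition alpha is 1 at a cycle in e |: F. *)
Lemma compatible_contr_vanishing_at (o : directions D) (A : finZmodType) (f : edge G -> A)
    (alpha : gassigning G) (F : {set edge H}) :
  ~~ is_loop e -> alpha =1 assigning_of o f -> f e = 0 ->
  compatible (contr_assigning e alpha) F = compatible alpha (e |: lift_edges F).
Proof.
move=> le alphaE fe; apply/idP/idP => [/compatibleP cF|/compatibleP cF]; last first.
  apply/compatibleP => K cycK sK; rewrite -[K]/(val (exist _ K cycK : gcycle H)) gvalE.
  have sL : lift_edges K \subset e |: lift_edges F.
    by apply: subset_trans (subsetUr _ _); rewrite lift_edgesS.
  have sU : e |: lift_edges K \subset e |: lift_edges F.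
    by apply: setUS; rewrite lift_edgesS.
  rewrite /contr_assigning /=; case: ifP => cycL; first exact: cF.
  by apply/negP => alphaU; have := cF _ (gval_cycle alphaU) sU; rewrite alphaU.
apply/(compatible_vanishes _ alphaE) => c sc; have [c' c'E] := push_chain c.
rewrite (sum_contr fe c'E).
have sc' : csupp c' \subset F.
  apply: csuppP => x xF; rewrite c'E; apply: (chain_out sc).
  by rewrite in_setU1 mem_lift_edges (negPf (valP x)).
apply: (pairing_vanishes (D := DH) (f := fun x => f (val x))) sc' => K' k' cycK' sK' k'K' _.
have [K [cycK KE alphaK]] := contr_cycle alpha le cycK' k'K'.
have := cF _ cycK' sK'; rewrite alphaK -[K]/(val (exist _ K cycK : gcycle G)) gvalE.
rewrite alphaE assigning_ofE negbK => /eqP sum0.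
set C : gcycle G := exist _ _ _ in sum0.
have [p pE] := push_chain (eta_chain o C).
have [x xK'] : exists x, x \in K' by apply/set0Pn; case/and3P: cycK'.
have sp : csupp p \subset K'.
  apply: csuppP => y yK'; rewrite pE; apply: (chain_out (F := K)); first by rewrite csupp_eta.
  by apply: contra yK' => yK; rewrite -mem_lift_edges -KE in_setD1 yK (valP y).
have px : p x != 0.
  rewrite pE mem_eta /=.
  by have : val x \in K :\ e by [rewrite KE mem_lift_edges]; rewrite in_setD1 => /andP[].
have sum_p : \sum_x f (val x) *~ p x = 0 by rewrite -(sum_contr fe pE).
have prop : k' *~ p x = p *~ k' x.
  by apply: cycle_chains_proportional cycK' _ sp xK'; rewrite k'K'.
have sum_k' : (\sum_x f (val x) *~ k' x) *~ p x = 0.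
  have := congr1 (fun c : Gamma contr_orientation => \sum_x f (val x) *~ (0 + c) x) prop.
  rewrite !(pairing_lin (fun x => f (val x)) 0) sum_p mul0rz.
  by rewrite big1 ?add0r // => y _; rewrite chain0 mulr0z.
have : p x \in [:: 0; 1; -1] by rewrite pE eta_sign.
rewrite !inE (negPf px) /= => /orP[] /eqP px1; move: sum_k'; rewrite px1 ?mulr1z //.
by rewrite mulrNz mulr1z => /eqP; rewrite oppr_eq0 => /eqP.
Qed.

End Contraction.

(** Subtracting from f the difference of a potential concentrated at the head of e
does not change the assigning and makes f vanish at e. *)
Lemma compatible_contr (G : mgraph) (D : orientation G) (o : directions D)
    (A : finZmodType) (f : edge G -> A) (alpha : gassigning G) (e : edge G)
    (F : {set edge (gcontr e)}) :
  ~~ is_loop e -> alpha =1 assigning_of o f ->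
  compatible (contr_assigning e alpha) F = compatible alpha (e |: lift_edges F).
Proof.
move=> le alphaE; pose p v : A := if v == head D e then f e else 0.
pose f0 y := f y - (p (head D y) - p (tail D y)).
have f0e : f0 e = 0.
  by move: le; rewrite (is_loopE D) /f0 /p eqxx => /negPf->; rewrite subr0 subrr.
apply: (compatible_contr_vanishing_at (f := f0)) f0e => // C; rewrite alphaE !assigning_ofE.
congr (_ != 0); rewrite -[LHS]subr0 -[X in _ - X](pairing_coboundary p (eta_chain o C)) -sumrB.
by apply: eq_bigr => y _; rewrite /f0 [RHS]mulrzBl.
Qed.

Lemma tau_contr (G : mgraph) (D : orientation G) (o : directions D)
    (A : finZmodType) (f : edge G -> A) (alpha : gassigning G) (e : edge G) :
  ~~ bridge e -> ~~ is_loop e -> alpha =1 assigning_of o f ->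
  tau alpha = tau (del_assigning e alpha) - tau (contr_assigning e alpha).
Proof.
move=> nbr nl alphaE; rewrite (tau_link D alpha nbr) [in RHS](tau_mkcond (contr_assigning e alpha)).
congr (_ - _); apply: eq_bigr => F _.
rewrite (compatible_contr _ nl alphaE) !(ncomp_contr D).
by rewrite [lift_edges [set: _]]lift_edgesT setU1_setC1.
Qed.

Theorem corollary3p2 (G : mgraph) (D : orientation G) (o : directions D)
    (alpha : gassigning G) (alpha_adm : admissible o alpha) :
  [/\ forall (k : nat) (A : finZmodType) (f : edge G -> A)
         (psi : {additive chain (incidence D) -> A}),
       #|A| = k ->
       assigning_of o f =1 alpha ->
       (forall C : gcycle G,
          psi (eta_chain o C) = - \sum_(e : edge G) f e *~ eta o C e) ->
       let p := assigning_poly (induced_assigning (cycle_matroid D) psi) in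
       [/\ tau alpha = p,
           (tau alpha).[k%:R] = p.[k%:R],
           p.[k%:R] = #|nz_solutions psi|%:R &
           #|nz_solutions psi| = #|Delta D f|],
      if [forall e : edge G, is_loop e ==> loop_val alpha e]
      then size (tau alpha) = (#|vertex G| - ncomp [set: edge G]).+1
      else tau alpha = 0,
      #|edge G| = 0%N -> tau alpha = 1 &
      forall e : edge G,
        [/\ bridge e ->
              tau alpha = ('X - 1) * tau (del_assigning e alpha),
            is_loop e ->
              tau alpha = (loop_val alpha e)%:R * tau (del_assigning e alpha) &
            ~~ bridge e -> ~~ is_loop e ->
              tau alpha = tau (del_assigning e alpha)
                          - tau (contr_assigning e alpha)]].
Proof.
have [A0 [f0 alphaE0]] := alpha_adm; split.
- move=> k A f psi <- alphaE psi_eta /=; have {}alphaE := fsym alphaE.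
  have tau_p := tau_assigning_poly alphaE psi_eta.
  have nzE := card_nz_solutions psi_eta; split=> //; first by rewrite tau_p.
  by rewrite -tau_p nzE; apply: tau_Delta alphaE.
- case: ifP => [/forallP loops1|/forallPn[e]].
    by apply: (size_tau D) => e; apply/implyP.
  by rewrite negb_imply => /andP[le /negPf ale]; rewrite (tau_loop D alpha le) ale mul0r.
- move=> E0; have noedge (e : edge G) : False by have := fintype0 e.
  rewrite tau_mkcond (bigD1 set0) //= big1 ?addr0 => [|F /set0Pn[e]]; last by case: (noedge e).
  rewrite (_ : [set: edge G] = set0); last by apply/setP => e; case: (noedge e).
  case: ifP => [_|/negP[]]; first by rewrite cards0 subnn scale1r.
  by apply/compatibleP => K /and3P[/set0Pn[e]]; case: (noedge e).
move=> e; split; first exact: tau_bridge o alpha e.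
  exact: tau_loop D alpha e.
by move=> nbr nl; apply: tau_contr alphaE0.
Qed.
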